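(* Let $0<\alpha<1$. Let $f=h+\bar g\in\mathcal{H}_0$ with $h,g$ analytic on $\mathbb{D}$, $h(z)=z+a_2z^2+a_3z^3+\cdots$ and $g(z)=b_1z+b_2z^2+b_3z^3+\cdots$. Suppose that the inequality $$\sum_{n=2}^{\infty}A_n(\alpha)|a_n|+\sum_{n=1}^{\infty}B_n(\alpha)|b_n|\le 2\sin\frac{\pi\alpha}{2}$$ holds, where $$A_n(\alpha)=n-1+|n-e^{-i\pi\alpha}|=n-1+\sqrt{n^2-2n\cos\pi\alpha+1},$$ $$B_n(\alpha)=n+1+|n+e^{i\pi\alpha}|=n+1+\sqrt{n^2+2n\cos\pi\alpha+1}.$$ Then $f\in\mathcal{SS}_{\mathrm{H}}(\alpha)$.
   Context: $\mathbb{D}=\{z\in\mathbb{C}:|z|<1\}$ and $\mathbb{D}_r=\{z:|z|<r\}$. $\mathcal{H}_0$ is the class of complex-valued harmonic functions $f$ on $\mathbb{D}$ with $f(0)=0$ and $f_z(0)=1$. Orientation-preserving means that the Jacobian $J_f=|f_z|^2-|f_{\bar z}|^2$ is positive on $\mathbb{D}$; univalent means injective. For $0<\alpha<1$ put $\tau=\tan(\pi\alpha/2)$ and let $V_\alpha$ be the Jordan domain bounded by the two logarithmic spiral segments $\{e^{(-\tau+i)\theta}:0\le\theta\le\pi\}$ and $\{e^{(\tau+i)\theta}:-\pi\le\theta\le 0\}$. Set $w_0V_\alpha=\{w_0w:w\in V_\alpha\}$. A domain $\Omega\subset\mathbb{C}$ is called strongly starlike of order $\alpha$ (with respect to the origin)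 if $w_0V_\alpha\subset\Omega$ for all $w_0\in\Omega$. The class $\mathcal{SS}_{\mathrm{H}}(\alpha)$ of hereditarily strongly starlike functions of order $\alpha$ consists of those $f\in\mathcal{H}_0$ which are orientation-preserving and univalent on $\mathbb{D}$ and such that $f(\mathbb{D}_r)$ is a strongly starlike domain of order $\alpha$ for each $0<r<1$. *)

(* Defs.v *)
From Stdlib Require Import Reals Psatz.
From Coquelicot Require Import Coquelicot.
Open Scope R_scope.

(** * Plane topology *)

Definition disk (r : R) (z : C) : Prop := Cmod z < r.

Definition image (f : C -> C) (S : C -> Prop) (w : C) : Prop :=
  exists z, S z /\ f z = w.

Definition connected (S : C -> Prop) : Prop :=
  forall U V : C -> Prop, open U -> open V ->
    (forall z, S z -> U z \/ V z) ->
    (exists z, S z /\ U z) -> (exists z, S z /\ V z) ->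
    exists z, S z /\ U z /\ V z.

Definition domain (S : C -> Prop) : Prop :=
  open S /\ connected S /\ exists z, S z.

Definition component (S : C -> Prop) (z w : C) : Prop :=
  exists T : C -> Prop,
    (forall x, T x -> S x) /\ connected T /\ T z /\ T w.

Definition bounded_set (S : C -> Prop) : Prop :=
  exists M : R, forall z, S z -> Cmod z <= M.

(** The union of the bounded components of the complement of [J]; when [J] is
    a Jordan curve there is exactly one, the Jordan domain bounded by [J]. *)
Definition jordan_domain (J : C -> Prop) (w : C) : Prop :=
  ~ J w /\ bounded_set (component (fun z => ~ J z) w).

(** * Strong starlikeness *)

Definition Cexp (z : C) : C :=
  (exp (Re z) * cos (Im z), exp (Re z) * sin (Im z)).

Definition spirals (alpha : R) (w : C) : Prop :=
  let tau := tan (PI * alpha / 2) in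
  (exists theta : R, 0 <= theta <= PI /\
     w = Cexp ((- RtoC tau + Ci) * RtoC theta)%C) \/
  (exists theta : R, - PI <= theta <= 0 /\
     w = Cexp ((RtoC tau + Ci) * RtoC theta)%C).

Definition Valpha (alpha : R) : C -> Prop := jordan_domain (spirals alpha).

Definition strongly_starlike (alpha : R) (Omega : C -> Prop) : Prop :=
  domain Omega /\
  forall w0, Omega w0 -> forall w, Valpha alpha w -> Omega (w0 * w)%C.

(** * Harmonic mappings of the unit disk *)

Definition re_part (f : C -> C) (x y : R) : R := Re (f (x, y)).
Definition im_part (f : C -> C) (x y : R) : R := Im (f (x, y)).

Definition real_harmonic_at (u : R -> R -> R) (x y : R) : Prop :=
  ex_diff_n u 2 x y /\ partial_derive 2 0 u x y + partial_derive 0 2 u x y = 0.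

Definition harmonic_on (D : C -> Prop) (f : C -> C) : Prop :=
  forall z, D z ->
    real_harmonic_at (re_part f) (Re z) (Im z) /\
    real_harmonic_at (im_part f) (Re z) (Im z).

Definition Cdx (f : C -> C) (z : C) : C :=
  (partial_derive 1 0 (re_part f) (Re z) (Im z),
   partial_derive 1 0 (im_part f) (Re z) (Im z)).

Definition Cdy (f : C -> C) (z : C) : C :=
  (partial_derive 0 1 (re_part f) (Re z) (Im z),
   partial_derive 0 1 (im_part f) (Re z) (Im z)).

(** Wirtinger derivatives [f_z] and [f_zbar]. *)
Definition Cdz (f : C -> C) (z : C) : C :=
  ((Cdx f z - Ci * Cdy f z) / RtoC 2)%C.

Definition Cdzbar (f : C -> C) (z : C) : C :=
  ((Cdx f z + Ci * Cdy f z) / RtoC 2)%C.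

Definition class_H0 (f : C -> C) : Prop :=
  harmonic_on (disk 1) f /\ f (RtoC 0) = RtoC 0 /\ Cdz f (RtoC 0) = RtoC 1.

Definition jacobian (f : C -> C) (z : C) : R :=
  Cmod (Cdz f z) ^ 2 - Cmod (Cdzbar f z) ^ 2.

Definition orientation_preserving (f : C -> C) : Prop :=
  forall z, disk 1 z -> 0 < jacobian f z.

Definition univalent (f : C -> C) : Prop :=
  forall z1 z2, disk 1 z1 -> disk 1 z2 -> f z1 = f z2 -> z1 = z2.

Definition class_SSH (alpha : R) (f : C -> C) : Prop :=
  class_H0 f /\ orientation_preserving f /\ univalent f /\
  forall r, 0 < r < 1 -> strongly_starlike alpha (image f (disk r)).

(** * Coefficients *)

Definition analytic_on (D : C -> Prop) (h : C -> C) : Prop :=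
  forall z, D z -> ex_derive h z.

Definition coefA (alpha : R) (n : nat) : R :=
  INR n - 1 + Cmod (RtoC (INR n) - Cexp (- (Ci * RtoC (PI * alpha))))%C.

Definition coefB (alpha : R) (n : nat) : R :=
  INR n + 1 + Cmod (RtoC (INR n) + Cexp (Ci * RtoC (PI * alpha)))%C.

Lemma coefA_sqrt (alpha : R) (n : nat) :
  coefA alpha n =
  INR n - 1 + sqrt (INR n ^ 2 - 2 * INR n * cos (PI * alpha) + 1).
Proof.
  unfold coefA; replace (- (Ci * RtoC (PI * alpha)))%C with (0, - (PI * alpha))
    by (apply injective_projections; simpl; ring).
  unfold Cmod, Cexp, Re, Im; cbn [fst snd Cminus Cplus Copp RtoC].
  rewrite exp_0, cos_neg, sin_neg; do 2 f_equal.
  pose proof (sin2_cos2 (PI * alpha)) as H; unfold Rsqr in H.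
  nra.
Qed.

Lemma coefB_sqrt (alpha : R) (n : nat) :
  coefB alpha n =
  INR n + 1 + sqrt (INR n ^ 2 + 2 * INR n * cos (PI * alpha) + 1).
Proof.
  unfold coefB; replace (Ci * RtoC (PI * alpha))%C with (0, PI * alpha)
    by (apply injective_projections; simpl; ring).
  unfold Cmod, Cexp, Re, Im; cbn [fst snd Cminus Cplus Copp RtoC].
  rewrite exp_0; do 2 f_equal.
  pose proof (sin2_cos2 (PI * alpha)) as H; unfold Rsqr in H.
  nra.
Qed.

(* Main.v *)
Require Import Defs.
From Stdlib Require Import Reals Lra Lia Psatz ClassicalEpsilon.
From Coquelicot Require Import Coquelicot.
Open Scope R_scope.

(** The coefficient condition is used twice, through different lower bounds for
    the weights A_n and B_n.

    The bounds A_n >= 2 n sin (pi alpha / 2) and B_n >= 2 n turn it into a bound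
    on the sums of n |a_n| (n >= 2) and n |b_n|, which makes f a perturbation of
    the identity: on each disk of radius rho < 1, f - id is Lipschitz with a
    constant less than 1.  Hence f is univalent, its Jacobian is positive, and,
    after f - id has been extended to the plane by composing it with the radial
    retraction onto the disk, f has a globally defined Lipschitz inverse G by
    Banach's fixed point theorem ([lipschitz_perturbation_inverse]).  So
    f(D_r) = {|G| < r} is open, and being a Lipschitz image of a disk it is
    connected.

    The exact values of A_n and B_n give, for each of the two numbers
    e = exp (+- i pi alpha), the inequality |Df - f| <= |Df - e f| between values
    of the Euler operator Df = z f_z - conj z f_zbar: the linear term of f
    contributes |1 - e| |z| = 2 sin (pi alpha / 2) |z| on the right, and A_n, B_n
    are the total weights of a_n, b_n in the remaining terms of both sides
    ([euler_halfplane]).  As |e| = 1, this says that Df / f lies in the half-plane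
    bounded by the perpendicular bisector of 1 and e, and since 1 - e is a
    positive multiple of tau +- i it amounts to Re (lam f conj Df) >= 0 for
    lam = tau + i and lam = tau - i, where tau = tan (pi alpha / 2).

    That sign is the derivative of |z|^2, up to a negative factor, along the curve
    z(t) with f(z(t)) = w0 exp (- lam t).  Therefore |z(t)| does not increase and
    f(D_r) is invariant under multiplication by exp (- lam t), t >= 0
    ([spiral_flow_invariance]).  The values lam = tau -+ i give invariance under
    the two bounding spirals of V_alpha, and lam = 1, their average up to a positive
    factor, gives invariance under contractions.  A nonzero point w of V_alpha is
    sigma / s with sigma on a spiral and s >= 1, because otherwise the ray from w
    away from the origin would avoid the spirals and w would lie in an unbounded
    component ([jordan_domain_radial]).  This avoids the Jordan curve theorem.

    All the inequalities along the flow are weak, since f(z) = z + b_1 conj z can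
    satisfy the coefficient condition with equality and then Re (lam f conj Df)
    may vanish; the monotonicity of |z(t)| is therefore derived from a one-sided
    Dini estimate with an arbitrarily small slope ([dini_nonincreasing]). *)

(** * Complex moduli and dominated series *)

Lemma pow_le_1 (x : R) (n : nat) : 0 <= x <= 1 -> x ^ n <= 1.
Proof. intro H. rewrite <- (pow1 n). apply pow_incr. exact H. Qed.

Lemma Cmod_triangle_minus (x y : C) : Cmod (x - y) <= Cmod x + Cmod y.
Proof.
  unfold Cminus. rewrite <- (Cmod_opp y). apply Cmod_triangle.
Qed.

Lemma Cmod_minus_sym (x y : C) : Cmod (x - y) = Cmod (y - x).
Proof. rewrite <- Cmod_opp. f_equal. ring. Qed.

Lemma Cmod_triangle_inv (x y : C) : Cmod x - Cmod y <= Cmod (x + y).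
Proof.
  pose proof (Cmod_triangle_minus (x + y) y) as H.
  replace (x + y - y)%C with x in H by ring. lra.
Qed.

Lemma Cmod_minus_le_0 (x y : C) : Cmod (x - y) <= 0 -> x = y.
Proof.
  intro H. replace x with ((x - y) + y)%C by ring.
  rewrite (Cmod_eq_0 (x - y)); [ring |].
  apply Rle_antisym; [assumption | apply Cmod_ge_0].
Qed.

Lemma Cmod_le_Cmod (x y : C) :
  Re x ^ 2 + Im x ^ 2 <= Re y ^ 2 + Im y ^ 2 -> Cmod x <= Cmod y.
Proof.
  intro H. unfold Cmod. apply sqrt_le_1_alt. exact H.
Qed.

Lemma Cmod_le_abs_sum (x : C) : Cmod x <= Rabs (Re x) + Rabs (Im x).
Proof.
  replace x with (RtoC (Re x) + Ci * RtoC (Im x))%C at 1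
    by (destruct x; apply injective_projections; simpl; ring).
  eapply Rle_trans; [apply Cmod_triangle |].
  rewrite Cmod_mult, Cmod_Ci, !Cmod_R. lra.
Qed.

Lemma is_series_Cmod_le (u : nat -> C) (v : nat -> R) (l : C) (L : R) :
  is_series u l -> is_series v L -> (forall n, Cmod (u n) <= v n) ->
  Cmod l <= L.
Proof.
  intros Hu Hv Huv.
  assert (Hlim : is_lim_seq (fun n => Cmod (sum_n u n)) (Cmod l)).
  { apply (filterlim_comp _ _ _ (sum_n u) Cmod eventually (locally l) _ Hu).
    apply (filterlim_norm (V := C_NormedModule) l). }
  refine (is_lim_seq_le _ (sum_n v) (Cmod l) L _ Hlim Hv).
  intro n. unfold sum_n.
  eapply Rle_trans; [apply (norm_sum_n_m u) |].
  apply sum_n_m_le. exact Huv.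
Qed.

Lemma ex_Cseries_le (u : nat -> C) (v : nat -> R) :
  (forall n, Cmod (u n) <= v n) -> ex_series v ->
  exists l : C, is_series u l.
Proof.
  intros Huv Hv.
  exact (ex_series_le (V := C_CompleteNormedModule) u v Huv Hv).
Qed.

Lemma is_Cseries_minus (u v : nat -> C) (a b : C) :
  is_series u a -> is_series v b ->
  is_series (fun n => (u n - v n)%C) (a - b)%C.
Proof. exact (is_series_minus (V := C_NormedModule) u v a b). Qed.

Lemma is_Cseries_scal (c : C) (u : nat -> C) (a : C) :
  is_series u a -> is_series (fun n => (c * u n)%C) (c * a)%C.
Proof. exact (is_series_scal_l (V := C_NormedModule) c u a). Qed.

Lemma is_series_tail {K : AbsRing} {V : NormedModule K} (u : nat -> V) (l : V) (N : nat) :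
  is_series u l ->
  is_series (fun k => u (S N + k)%nat) (minus l (sum_n u N)).
Proof.
  intro Hu. apply is_series_incr_n; [lia |].
  change (is_series u (plus (plus l (opp (sum_n u N))) (sum_n u N))).
  replace (plus (plus l (opp (sum_n u N))) (sum_n u N)) with l; [exact Hu |].
  rewrite <- (plus_assoc l). symmetry.
  etransitivity; [apply f_equal; apply (plus_opp_l (sum_n u N)) | apply plus_zero_r].
Qed.

(** Lets the sums of the hypotheses, which start at index one or two, be read as sums
    over all indices. *)
Lemma is_series_from {K : AbsRing} {V : NormedModule K} (u : nat -> V) (k : nat) (l : V) :
  (forall n, (n < k)%nat -> u n = zero) -> is_series (fun n => u (k + n)%nat) l ->
  is_series u l.
Proof.
  revert u. induction k as [| k IH]; intros u Hu H; [exact H |].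
  apply is_series_decr_1.
  assert (E : plus l (opp (u O)) = l).
  { rewrite Hu by lia. exact (minus_zero_r l). }
  rewrite E. apply IH; [| exact H]. intros n Hn. apply Hu. lia.
Qed.

Lemma is_series_le (u v : nat -> R) (l L : R) :
  (forall n, u n <= v n) -> is_series u l -> is_series v L -> l <= L.
Proof.
  intros Huv Hu Hv. refine (is_lim_seq_le (sum_n u) (sum_n v) l L _ Hu Hv).
  intro n. apply sum_n_m_le. exact Huv.
Qed.

Lemma ex_series_le_pos (u v : nat -> R) :
  (forall n, 0 <= u n <= v n) -> ex_series v -> ex_series u.
Proof.
  intros Huv. apply (ex_series_le (K := R_AbsRing) (V := R_CompleteNormedModule)).
  intro n. unfold norm; simpl. unfold abs; simpl. rewrite Rabs_pos_eq; apply Huv.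
Qed.

Lemma dominated_series (u v : nat -> R) (k L : R) : 0 < k ->
  (forall n, 0 <= u n) -> (forall n, k * u n <= v n) -> is_series v L ->
  exists l, is_series u l /\ 0 <= l /\ k * l <= L.
Proof.
  intros Hk Hu Huv Hv.
  assert (Hex : ex_series u).
  { apply (ex_series_le_pos u (fun n => / k * v n)).
    - intro n. split; [apply Hu |]. apply Rmult_le_reg_l with k; [assumption |].
      rewrite <- Rmult_assoc, Rinv_r by lra. specialize (Huv n). lra.
    - apply (ex_series_scal_l (K := R_AbsRing) (V := R_NormedModule)). exists L. exact Hv. }
  destruct Hex as [l Hl]. exists l. split; [assumption |]. split.
  - assert (0 * l <= l); [| lra].
    apply (is_series_le (fun n => 0 * u n) u); [| | exact Hl].
    + intro n. specialize (Hu n). lra.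
    + exact (is_series_scal_l (K := R_AbsRing) (V := R_NormedModule) 0 u l Hl).
  - apply (is_series_le (fun n => k * u n) v); [exact Huv | | exact Hv].
    exact (is_series_scal_l (K := R_AbsRing) (V := R_NormedModule) k u l Hl).
Qed.

Lemma split_series (u v w : nat -> R) (L : R) :
  (forall n, 0 <= u n) -> (forall n, 0 <= v n) -> (forall n, u n + v n = w n) ->
  is_series w L ->
  exists l1 l2, is_series u l1 /\ is_series v l2 /\ l1 + l2 = L.
Proof.
  intros Hu Hv Hw HL.
  destruct (dominated_series u w 1 L Rlt_0_1 Hu) as [l1 [H1 _]]; [| exact HL |].
  { intro n. specialize (Hv n). specialize (Hw n). lra. }
  exists l1, (L - l1). split; [assumption |]. split; [| lra].
  pose proof (is_series_minus _ _ _ _ HL H1) as H2.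
  eapply is_series_ext; [| exact H2]. intro n. specialize (Hw n).
  change (w n - u n = v n). lra.
Qed.

(** * Power series with summable derivative coefficients *)

(** Real differentiability in complex form: [p] and [q] are the derivatives with
    respect to [z] and its conjugate, and [q = 0] is complex differentiability.
    Working with increments keeps the later algebra in complex notation. *)
Definition wirtinger (f : C -> C) (z p q : C) : Prop :=
  forall eps, 0 < eps -> exists delta, 0 < delta /\
    forall k, Cmod k < delta ->
      Cmod (f (z + k) - f z - (p * k + q * Cconj k))%C <= eps * Cmod k.

Lemma is_pseries_Cpow (c : nat -> C) (z l : C) :
  is_pseries c z l -> is_series (fun n => (c n * z ^ n)%C) l.
Proof.
  apply is_series_ext. intro n.
  assert (Hp : pow_n z n = (z ^ n)%C).
  { induction n as [| n IH]; [reflexivity |]. simpl. rewrite <- IH. reflexivity. }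
  change (pow_n z n * c n = c n * z ^ n)%C. rewrite Hp. apply Cmult_comm.
Qed.

Lemma Cpow_lipschitz (rho : R) (z1 z2 : C) (n : nat) :
  Cmod z1 <= rho -> Cmod z2 <= rho ->
  Cmod (z1 ^ n - z2 ^ n) <= INR n * rho ^ pred n * Cmod (z1 - z2).
Proof.
  intros H1 H2.
  pose proof (Cmod_ge_0 z1) as Hz1. pose proof (Cmod_ge_0 (z1 - z2)) as Hz12.
  induction n as [| n IH].
  - simpl. replace (1 - 1)%C with (RtoC 0) by ring. rewrite Cmod_0. lra.
  - replace (z1 ^ S n - z2 ^ S n)%C
      with ((z1 * (z1 ^ n - z2 ^ n)) + ((z1 - z2) * z2 ^ n))%C
      by (simpl; ring).
    eapply Rle_trans; [apply Cmod_triangle |].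
    rewrite !Cmod_mult, Cmod_pow, S_INR. simpl pred.
    assert (Hp : Cmod z2 ^ n <= rho ^ n)
      by (apply pow_incr; split; [apply Cmod_ge_0 | assumption]).
    assert (Hq : rho * (INR n * rho ^ pred n) = INR n * rho ^ n).
    { destruct n; simpl pred; [simpl; ring | simpl pow; ring]. }
    apply Rle_trans with
      (rho * (INR n * rho ^ pred n * Cmod (z1 - z2)) + Cmod (z1 - z2) * rho ^ n).
    + apply Rplus_le_compat.
      * apply Rmult_le_compat; auto using Cmod_ge_0.
      * apply Rmult_le_compat_l; auto.
    + replace (rho * (INR n * rho ^ pred n * Cmod (z1 - z2)))
        with (INR n * rho ^ n * Cmod (z1 - z2)) by (rewrite <- Hq; ring).
      lra.
Qed.

Lemma Cpow_taylor (z k : C) (n : nat) :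
  Cmod z <= 1 -> Cmod (z + k) <= 1 ->
  Cmod ((z + k) ^ n - z ^ n - RtoC (INR n) * z ^ pred n * k)
    <= INR n ^ 2 * Cmod k ^ 2.
Proof.
  intros H1 H2.
  pose proof (Cmod_ge_0 k) as Hk.
  induction n as [| n IH].
  - simpl. replace (1 - 1 - 0 * 1 * k)%C with (RtoC 0) by ring.
    rewrite Cmod_0. lra.
  - assert (Hq : (z * (RtoC (INR n) * z ^ pred n) = RtoC (INR n) * z ^ n)%C).
    { destruct n; simpl pred; [simpl; ring | rewrite Cpow_S; ring]. }
    rewrite S_INR.
    replace ((z + k) ^ S n - z ^ S n - RtoC (INR n + 1) * z ^ pred (S n) * k)%C
      with ((z + k) * ((z + k) ^ n - z ^ n - RtoC (INR n) * z ^ pred n * k)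
            + RtoC (INR n) * z ^ pred n * (k * k))%C.
    2:{ rewrite RtoC_plus, !Cpow_S. simpl pred.
        transitivity ((z + k) * (z + k) ^ n - (z + k) * z ^ n
          - (z * (RtoC (INR n) * z ^ pred n)) * k)%C; [ring |].
        rewrite Hq. ring. }
    eapply Rle_trans; [apply Cmod_triangle |].
    rewrite !Cmod_mult, Cmod_pow, Cmod_R, (Rabs_pos_eq (INR n)) by apply pos_INR.
    assert (Hp : Cmod z ^ pred n <= 1).
    { apply pow_le_1.
      split; [apply Cmod_ge_0 | assumption]. }
    pose proof (pos_INR n) as Hn.
    pose proof (Cmod_ge_0 ((z + k) ^ n - z ^ n - RtoC (INR n) * z ^ pred n * k)).
    pose proof (Cmod_ge_0 (z + k)).
    apply Rle_trans with (1 * (INR n ^ 2 * Cmod k ^ 2)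
                          + INR n * 1 * (Cmod k * Cmod k)).
    + apply Rplus_le_compat; [apply Rmult_le_compat; auto |].
      apply Rmult_le_compat_r; [nra |]. apply Rmult_le_compat_l; auto.
    + assert (0 <= INR n * Cmod k ^ 2) by (apply Rmult_le_pos; nra). nra.
Qed.

Lemma pseries_lipschitz (c : nat -> C) (H : C -> C) (v : nat -> R) (rho L : R)
  (z1 z2 : C) :
  Cmod z1 < 1 -> Cmod z2 < 1 ->
  Cmod z1 <= rho -> Cmod z2 <= rho ->
  (forall z, disk 1 z -> is_pseries c z (H z)) ->
  (forall n, INR n * rho ^ pred n * Cmod (c n) <= v n) -> is_series v L ->
  Cmod (H z1 - H z2) <= L * Cmod (z1 - z2).
Proof.
  intros U1 U2 H1 H2 Hc Hv HL.
  pose proof (is_Cseries_minus _ _ _ _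
    (is_pseries_Cpow _ _ _ (Hc z1 U1)) (is_pseries_Cpow _ _ _ (Hc z2 U2))) as Hd.
  refine (is_series_Cmod_le _ _ _ _ Hd (is_series_scal_r (Cmod (z1 - z2)) _ _ HL) _).
  intro n. cbv beta.
  replace (c n * z1 ^ n - c n * z2 ^ n)%C with (c n * (z1 ^ n - z2 ^ n))%C by ring.
  rewrite Cmod_mult.
  pose proof (Cpow_lipschitz rho z1 z2 n H1 H2). pose proof (Cmod_ge_0 (c n)).
  pose proof (Cmod_ge_0 (z1 - z2)). specialize (Hv n).
  apply Rle_trans with (INR n * rho ^ pred n * Cmod (c n) * Cmod (z1 - z2)); nra.
Qed.

(** Termwise differentiation. The tail is a Lipschitz function with small constant, because
    [INR n * Cmod (c n)] is summable ([Cpow_lipschitz]); so the quadratic remainder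
    [Cpow_taylor] has to be summed over an initial segment only. *)
Lemma pseries_derivative (c : nat -> C) (H : C -> C) (W : R) (z : C) :
  Cmod z < 1 ->
  (forall z, disk 1 z -> is_pseries c z (H z)) ->
  is_series (fun n => INR n * Cmod (c n)) W ->
  exists l, is_series (fun n => (RtoC (INR n) * c n * z ^ pred n)%C) l /\
            wirtinger H z l (RtoC 0).
Proof.
  intros Hz Hc HS.
  assert (Hpow : forall n, Cmod z ^ n <= 1).
  { intro n. apply pow_le_1. split; [apply Cmod_ge_0 | lra]. }
  destruct (ex_Cseries_le (fun n => (RtoC (INR n) * c n * z ^ pred n)%C)
              (fun n => INR n * Cmod (c n))) as [l Hl].
  { intro n. rewrite !Cmod_mult, Cmod_pow, Cmod_R, Rabs_pos_eq by apply pos_INR.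
    pose proof (Hpow (pred n)).
    assert (0 <= INR n * Cmod (c n))
      by (apply Rmult_le_pos; [apply pos_INR | apply Cmod_ge_0]).
    nra. }
  { exists W. exact HS. }
  exists l. split; [exact Hl |].
  intros eps Heps.
  (* [N] is such that the terms beyond it contribute at most [eps / 2 * Cmod k]; the
     finitely many others are quadratic in [k] *)
  assert (HS' : is_lim_seq (sum_n (fun n => INR n * Cmod (c n))) W) by exact HS.
  apply is_lim_seq_spec in HS'.
  destruct (HS' (mkposreal (eps / 4) ltac:(lra))) as [N HN].
  specialize (HN N (Nat.le_refl N)). simpl in HN.
  apply Rabs_def2 in HN.
  set (SN := sum_n (fun n => INR n * Cmod (c n)) N) in *.
  assert (HSN : 0 <= SN).
  { unfold SN. rewrite sum_n_Reals. apply cond_pos_sum. intro k.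
    apply Rmult_le_pos; [apply pos_INR | apply Cmod_ge_0]. }
  pose proof (pos_INR N) as HNpos.
  assert (HD : 0 < 2 * (INR N * SN + 1)) by nra.
  exists (Rmin (1 - Cmod z) (eps / (2 * (INR N * SN + 1)))). split.
  { apply Rmin_pos; [lra |]. apply Rdiv_lt_0_compat; lra. }
  intros k Hk.
  assert (Hk1 : Cmod k < 1 - Cmod z) by (eapply Rlt_le_trans; [exact Hk | apply Rmin_l]).
  assert (Hk2 : Cmod k < eps / (2 * (INR N * SN + 1)))
    by (eapply Rlt_le_trans; [exact Hk | apply Rmin_r]).
  assert (Hk3 : INR N * SN * Cmod k <= eps / 2).
  { apply Rlt_div_r in Hk2; [| lra]. pose proof (Cmod_ge_0 k). nra. }
  assert (Hzk : Cmod (z + k) < 1) by (pose proof (Cmod_triangle z k); lra).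
  set (d := fun n => (c n * ((z + k) ^ n - z ^ n - RtoC (INR n) * z ^ pred n * k))%C).
  assert (Hd : is_series d (H (z + k)%C - H z - l * k)%C).
  { pose proof (is_Cseries_minus _ _ _ _ (is_Cseries_minus _ _ _ _
      (is_pseries_Cpow _ _ _ (Hc _ Hzk)) (is_pseries_Cpow _ _ _ (Hc z Hz)))
      (is_Cseries_scal k _ _ Hl)) as Hd.
    replace (H (z + k)%C - H z - l * k)%C with (H (z + k)%C - H z - k * l)%C by ring.
    eapply is_series_ext; [| exact Hd]. intro n. unfold d.
    match goal with |- ?x = ?y => change (@eq C x y) end. ring. }
  assert (Hd1 : forall n, Cmod (d n) <= INR n ^ 2 * Cmod (c n) * Cmod k ^ 2).
  { intro n. unfold d. rewrite Cmod_mult.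
    pose proof (Cpow_taylor z k n ltac:(lra) ltac:(lra)).
    pose proof (Cmod_ge_0 (c n)). nra. }
  assert (Hd2 : forall n, Cmod (d n) <= INR n * Cmod (c n) * (2 * Cmod k)).
  { intro n. unfold d. rewrite Cmod_mult.
    pose proof (Cpow_lipschitz 1 (z + k)%C z n ltac:(lra) ltac:(lra)) as HL.
    rewrite pow1 in HL. replace (z + k - z)%C with k in HL by ring.
    pose proof (Cmod_triangle_minus ((z + k) ^ n - z ^ n) (RtoC (INR n) * z ^ pred n * k)) as HT.
    rewrite !Cmod_mult, Cmod_pow, Cmod_R, Rabs_pos_eq in HT by apply pos_INR.
    pose proof (Hpow (pred n)) as HP. pose proof (Cmod_ge_0 (c n)).
    pose proof (pos_INR n). pose proof (Cmod_ge_0 k).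
    assert (INR n * Cmod z ^ pred n * Cmod k <= INR n * Cmod k).
    { apply Rmult_le_compat_r; [assumption |]. nra. }
    assert (Cmod ((z + k) ^ n - z ^ n - RtoC (INR n) * z ^ pred n * k)
      <= 2 * (INR n * Cmod k)) by lra.
    nra. }
  replace (H (z + k)%C - H z - (l * k + 0 * Cconj k))%C
    with (H (z + k)%C - H z - l * k)%C by ring.
  set (D := (H (z + k)%C - H z - l * k)%C) in *.
  assert (Ht : Cmod (D - sum_n d N) <= (W - SN) * (2 * Cmod k)).
  { pose proof (is_series_tail d D N Hd) as T1.
    pose proof (is_series_tail _ _ N (is_series_scal_r (2 * Cmod k) _ _ HS)) as T2.
    pose proof (is_series_Cmod_le _ _ _ _ T1 T2 (fun j => Hd2 _)) as HT.
    pose proof (sum_n_mult_r (K := R_Ring) (2 * Cmod k)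
                  (fun n => INR n * Cmod (c n)) N) as E.
    change (Cmod (D - sum_n d N) <= W * (2 * Cmod k)
      - sum_n (fun n => mult (INR n * Cmod (c n)) (2 * Cmod k)) N) in HT.
    rewrite E in HT. change (Cmod (D - sum_n d N) <= W * (2 * Cmod k) - SN * (2 * Cmod k)) in HT.
    lra. }
  assert (Hs : Cmod (sum_n d N) <= INR N * SN * Cmod k ^ 2).
  { apply Rle_trans with (sum_n (fun n => INR N * Cmod k ^ 2 * (INR n * Cmod (c n))) N).
    - eapply Rle_trans; [apply (norm_sum_n_m d) |].
      apply Rle_trans with (sum_n (fun n => norm (d n)) N); [apply Rle_refl |].
      rewrite !sum_n_Reals. apply sum_Rle. intros n Hn.
      eapply Rle_trans; [apply Hd1 |].
      apply le_INR in Hn. pose proof (pos_INR n). pose proof (Cmod_ge_0 (c n)).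
      assert (0 <= INR n * Cmod (c n) * Cmod k ^ 2)
        by (apply Rmult_le_pos; [apply Rmult_le_pos; assumption | apply pow2_ge_0]).
      nra.
    - right. rewrite (sum_n_mult_l (K := R_Ring) (INR N * Cmod k ^ 2)).
      change (INR N * Cmod k ^ 2 * SN = INR N * SN * Cmod k ^ 2). ring. }
  replace D with ((D - sum_n d N) + sum_n d N)%C by ring.
  eapply Rle_trans; [apply Cmod_triangle |].
  pose proof (Cmod_ge_0 k). nra.
Qed.

(** [z * l - mu * H z] has the coefficients [(n - mu) * c n]. With no constant term, every
    power that occurs is at most [Cmod z] in modulus, which keeps that factor outside. *)
Lemma pseries_euler_bound (c : nat -> C) (H : C -> C) (z l mu : C) (T : R) :
  Cmod z < 1 -> c 0%nat = RtoC 0 ->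
  (forall z, disk 1 z -> is_pseries c z (H z)) ->
  is_series (fun n => (RtoC (INR n) * c n * z ^ pred n)%C) l ->
  is_series (fun n => Cmod (RtoC (INR n) - mu) * Cmod (c n)) T ->
  Cmod (z * l - mu * H z) <= Cmod z * T.
Proof.
  intros Hz Hc0 Hc Hl HT.
  pose proof (is_Cseries_minus _ _ _ _ (is_Cseries_scal z _ _ Hl)
    (is_Cseries_scal mu _ _ (is_pseries_Cpow _ _ _ (Hc z Hz)))) as Hd.
  refine (is_series_Cmod_le _ _ _ _ Hd
            (is_series_scal_l (K := R_AbsRing) (V := R_NormedModule) (Cmod z) _ _ HT) _).
  intros [| n]; cbv beta.
  - rewrite Hc0.
    match goal with |- Cmod ?x <= _ => replace x with (RtoC 0) by (simpl; ring) end.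
    rewrite !Cmod_0. unfold scal; simpl; unfold mult; simpl. lra.
  - replace (z * (RtoC (INR (S n)) * c (S n) * z ^ pred (S n)) - mu * (c (S n) * z ^ S n))%C
      with (z * ((RtoC (INR (S n)) - mu) * c (S n) * z ^ n))%C
      by (rewrite Cpow_S; simpl pred; ring).
    rewrite !Cmod_mult, Cmod_pow.
    change (Cmod z * (Cmod (INR (S n) - mu) * Cmod (c (S n)) * Cmod z ^ n) <=
            Cmod z * (Cmod (INR (S n) - mu) * Cmod (c (S n)))).
    apply Rmult_le_compat_l; [apply Cmod_ge_0 |].
    assert (Cmod z ^ n <= 1).
    { apply pow_le_1. split; [apply Cmod_ge_0 | lra]. }
    pose proof (Cmod_ge_0 (INR (S n) - mu)). pose proof (Cmod_ge_0 (c (S n))).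
    assert (0 <= Cmod (INR (S n) - mu) * Cmod (c (S n))) by nra. nra.
Qed.

(** * Open and connected sets in the plane *)

Lemma open_Cmod (U : C -> Prop) (x : C) :
  open U -> U x -> exists eps, 0 < eps /\ forall y, Cmod (y - x) < eps -> U y.
Proof.
  intros HU Hx. destruct (HU x Hx) as [eps Heps].
  exists eps. split; [apply cond_pos |]. intros y Hy.
  apply Heps. apply C_NormedModule_mixin_compat1. exact Hy.
Qed.

Lemma Cmod_open (U : C -> Prop) :
  (forall x, U x -> exists eps, 0 < eps /\ forall y, Cmod (y - x) < eps -> U y) ->
  open U.
Proof.
  intros HU x Hx. destruct (HU x Hx) as [eps [Heps H]].
  exists (mkposreal (eps / 2) ltac:(lra)). intros y Hy. apply H.
  eapply Rlt_le_trans; [exact (C_NormedModule_mixin_compat2 x y _ Hy) |].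
  simpl. assert (sqrt 2 <= 2).
  { rewrite <- (sqrt_square 2) at 2 by lra. apply sqrt_le_1; lra. }
  nra.
Qed.

Lemma connected_of_paths (S : C -> Prop) :
  (forall z1 z2, S z1 -> S z2 -> exists (gamma : R -> C) (K : R),
     gamma 0 = z1 /\ gamma 1 = z2 /\ (forall t, 0 <= t <= 1 -> S (gamma t)) /\
     forall s t, 0 <= s <= 1 -> 0 <= t <= 1 ->
       Cmod (gamma s - gamma t) <= K * Rabs (s - t)) ->
  connected S.
Proof.
  intros Hpath U V HU HV HUV [z1 [Sz1 Uz1]] [z2 [Sz2 Vz2]].
  destruct (Hpath z1 z2 Sz1 Sz2) as [gamma [K [H0 [H1 [HS Hlip]]]]].
  assert (Hnear : forall W t, open W -> 0 <= t <= 1 -> W (gamma t) ->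
    exists d, 0 < d /\ forall s, 0 <= s <= 1 -> Rabs (s - t) < d -> W (gamma s)).
  { intros W t HW Ht Wt. destruct (open_Cmod W _ HW Wt) as [e [He Hball]].
    exists (e / (Rabs K + 1)). pose proof (Rabs_pos K) as HK.
    split; [apply Rdiv_lt_0_compat; lra |].
    intros s Hs Hst. apply Hball. eapply Rle_lt_trans; [apply Hlip; assumption |].
    apply Rlt_div_r in Hst; [| lra].
    pose proof (Rle_abs K). pose proof (Rabs_pos (s - t)). nra. }
  (* the last parameter approached from within [U] *)
  destruct (completeness (fun t => 0 <= t <= 1 /\ U (gamma t))) as [t1 [Hub Hlub]].
  { exists 1. intros t [Ht _]. lra. }
  { exists 0. split; [lra | rewrite H0; exact Uz1]. }
  assert (Ht1 : 0 <= t1 <= 1).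
  { split; [apply Hub; split; [lra | rewrite H0; exact Uz1] |].
    apply Hlub. intros t [Ht _]. lra. }
  destruct (HUV (gamma t1) (HS t1 Ht1)) as [HUt | HVt].
  - destruct (Rle_lt_or_eq_dec t1 1 ltac:(lra)) as [Hlt | Heq].
    + exfalso. destruct (Hnear U t1 HU Ht1 HUt) as [d [Hd Hs]].
      set (s := t1 + Rmin (d / 2) (1 - t1)).
      assert (0 < Rmin (d / 2) (1 - t1)) by (apply Rmin_pos; lra).
      pose proof (Rmin_l (d / 2) (1 - t1)). pose proof (Rmin_r (d / 2) (1 - t1)).
      assert (s <= t1); [| unfold s in *; lra].
      apply Hub. split; [unfold s; lra |].
      apply Hs; [unfold s; lra |]. unfold s.
      rewrite Rabs_pos_eq; lra.
    + exists (gamma t1). repeat split; [apply HS; assumption | assumption |].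
      rewrite Heq, H1. exact Vz2.
  - destruct (Hnear V t1 HV Ht1 HVt) as [d [Hd Hs]].
    destruct (classic (exists t, t1 - d < t /\ 0 <= t <= 1 /\ U (gamma t)))
      as [[t [Htd [Ht HUt]]] | Hno].
    + exists (gamma t). repeat split; [apply HS; assumption | assumption |].
      apply Hs; [assumption |]. assert (t <= t1) by (apply Hub; auto).
      apply Rabs_def1; lra.
    + exfalso. assert (t1 <= t1 - d); [| lra]. apply Hlub. intros t [Ht HUt].
      apply Rnot_lt_le. intro. apply Hno. exists t. auto.
Qed.

(** If the ray from [w] away from the origin avoided [J], it would be an unbounded
    connected subset of the component of [w]. *)
Lemma jordan_domain_radial (J : C -> Prop) (w : C) :
  jordan_domain J w -> w = RtoC 0 \/ exists s, 1 <= s /\ J (RtoC s * w)%C.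
Proof.
  intros [_ [M HM]]. apply NNPP. intro Hno.
  assert (Hw : w <> RtoC 0) by (intro; apply Hno; left; assumption).
  apply Cmod_gt_0 in Hw.
  set (s0 := 1 + Rabs M / Cmod w).
  assert (Hq : 0 <= Rabs M / Cmod w) by (apply Rdiv_le_0_compat; [apply Rabs_pos | assumption]).
  assert (Hc : component (fun z => ~ J z) w (RtoC s0 * w)%C).
  { exists (fun x => exists s, 1 <= s /\ x = (RtoC s * w)%C). split; [| split; [| split]].
    - intros x [s [Hs ->]] HJ. apply Hno. right. exists s. auto.
    - apply connected_of_paths. intros z1 z2 [s1 [Hs1 ->]] [s2 [Hs2 ->]].
      exists (fun t => RtoC (s1 + t * (s2 - s1)) * w)%C, (Rabs (s2 - s1) * Cmod w).
      split; [f_equal; f_equal; ring |]. split; [f_equal; f_equal; ring |]. split.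
      + intros t Ht. exists (s1 + t * (s2 - s1)). split; [nra | reflexivity].
      + intros s t _ _. right.
        replace (RtoC (s1 + s * (s2 - s1)) * w - RtoC (s1 + t * (s2 - s1)) * w)%C
          with (RtoC ((s2 - s1) * (s - t)) * w)%C
          by (rewrite !RtoC_plus, !RtoC_mult, !RtoC_minus; ring).
        rewrite Cmod_mult, Cmod_R, Rabs_mult. ring.
    - exists 1. split; [lra | ring].
    - exists s0. split; [unfold s0; lra | reflexivity]. }
  apply HM in Hc. rewrite Cmod_mult, Cmod_R in Hc.
  rewrite Rabs_pos_eq in Hc by (unfold s0; lra).
  unfold s0 in Hc. rewrite Rmult_plus_distr_r in Hc.
  replace (Rabs M / Cmod w * Cmod w) with (Rabs M) in Hc by (field; lra).
  pose proof (Rle_abs M). lra.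
Qed.

(** * Lipschitz perturbations of the identity *)

Lemma lipschitz_perturbation_inverse (phi : C -> C) (m : R) :
  0 <= m < 1 ->
  (forall z1 z2, Cmod (phi z1 - phi z2) <= m * Cmod (z1 - z2)) ->
  exists G : C -> C,
    (forall w, G w + phi (G w) = w)%C /\
    (forall w1 w2, Cmod (G w1 - G w2) <= / (1 - m) * Cmod (w1 - w2)) /\
    (forall z, G (z + phi z)%C = z).
Proof.
  intros Hm Hphi.
  assert (Hexp : forall z1 z2,
    (1 - m) * Cmod (z1 - z2) <= Cmod ((z1 + phi z1) - (z2 + phi z2))).
  { intros z1 z2. pose proof (Cmod_triangle_minus
      ((z1 + phi z1) - (z2 + phi z2)) (phi z1 - phi z2)) as H.
    replace (z1 + phi z1 - (z2 + phi z2) - (phi z1 - phi z2))%C with (z1 - z2)%C in H by ring.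
    specialize (Hphi z1 z2). lra. }
  assert (Hsol : forall w, exists z, (z + phi z)%C = w).
  { intro w.
    (* the fixed point of [z |-> w - phi z], as the limit of its iterates *)
    set (x := fix x n := match n with O => w | S n => (w - phi (x n))%C end).
    set (d := fun n => (x (S n) - x n)%C).
    set (D := Cmod (d O)). assert (HD : 0 <= D) by apply Cmod_ge_0.
    assert (Hd : forall n, Cmod (d n) <= m ^ n * D).
    { induction n as [| n IH]; [simpl; unfold D; lra |].
      apply Rle_trans with (m * Cmod (d n)).
      - unfold d. replace (x (S (S n)) - x (S n))%C with (phi (x n) - phi (x (S n)))%C
          by (simpl; ring).
        rewrite (Cmod_minus_sym (x (S n))). apply Hphi.
      - simpl. nra. }
    assert (Hgeo : is_series (fun n => m ^ n) (/ (1 - m)))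
      by (apply is_series_geom; rewrite Rabs_pos_eq; lra).
    destruct (ex_Cseries_le d (fun n => m ^ n * D) Hd) as [l Hl].
    { apply (ex_series_scal_r D). exists (/ (1 - m)). exact Hgeo. }
    assert (Hsum : forall n, sum_n d n = (x (S n) - w)%C).
    { induction n as [| n IH]; [rewrite sum_O; reflexivity |].
      rewrite sum_Sn, IH.
      change ((x (S n) - w) + (x (S (S n)) - x (S n)) = x (S (S n)) - w)%C. ring. }
    (* the increments telescope to [x (S n) - w] *)
    set (z := (w + l)%C). set (B := D * / (1 - m)).
    assert (Hz : forall n, Cmod (z - x (S n)) <= m ^ S n * B).
    { intro n. pose proof (is_series_tail d l n Hl) as Ht.
      pose proof (is_series_scal_l (K := R_AbsRing) (V := R_NormedModule)
                    (m ^ S n * D) _ _ Hgeo) as Hg.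
      pose proof (is_series_Cmod_le _ _ _ _ Ht Hg) as H.
      replace (z - x (S n))%C with (minus l (sum_n d n)).
      - replace (m ^ S n * B) with (scal (m ^ S n * D) (/ (1 - m)))
          by (unfold B, scal; simpl; unfold mult; simpl; ring).
        apply H. intro k. eapply Rle_trans; [apply Hd |].
        rewrite pow_add. right. unfold scal; simpl; unfold mult; simpl. ring.
      - rewrite Hsum. change (l - (x (S n) - w) = z - x (S n))%C. unfold z. ring. }
    exists z. apply Cmod_minus_le_0.
    apply Rnot_lt_le. intro Hpos. set (e := Cmod (z + phi z - w)) in *.
    assert (HB : 0 <= B).
    { unfold B. apply Rmult_le_pos; [assumption |].
      left. apply Rinv_0_lt_compat. lra. }
    destruct (pow_lt_1_zero m ltac:(rewrite Rabs_pos_eq; lra) (e / (2 * (B + 1))))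
      as [N HN]; [apply Rdiv_lt_0_compat; lra |].
    specialize (HN (S (S N)) ltac:(lia)).
    rewrite Rabs_pos_eq in HN by (apply pow_le; lra).
    apply Rlt_div_r in HN; [| lra].
    assert (He : e <= m ^ S (S N) * B + m * (m ^ S N * B)).
    { unfold e. replace (z + phi z - w)%C
        with ((z - x (S (S N))) + (phi z - phi (x (S N))))%C by (simpl; ring).
      eapply Rle_trans; [apply Cmod_triangle |].
      apply Rplus_le_compat; [apply Hz |].
      eapply Rle_trans; [apply Hphi |]. apply Rmult_le_compat_l; [lra | apply Hz]. }
    pose proof (pow_le m (S (S N)) ltac:(lra)).
    change (m ^ S (S N)) with (m * m ^ S N) in *. nra. }
  set (G := fun w => proj1_sig (constructive_indefinite_description _ (Hsol w))).
  assert (HG : forall w, (G w + phi (G w))%C = w)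
    by (intro w; exact (proj2_sig (constructive_indefinite_description _ (Hsol w)))).
  exists G. split; [exact HG |]. split.
  - intros w1 w2. pose proof (Hexp (G w1) (G w2)) as H. rewrite !HG in H.
    apply Rmult_le_reg_l with (1 - m); [lra |].
    rewrite <- Rmult_assoc, Rinv_r by lra. lra.
  - intro z. pose proof (Hexp (G (z + phi z)%C) z) as H. rewrite HG in H.
    replace (z + phi z - (z + phi z))%C with (RtoC 0) in H by ring.
    rewrite Cmod_0 in H. apply Cmod_minus_le_0.
    pose proof (Cmod_ge_0 (G (z + phi z)%C - z)). nra.
Qed.

Definition retract (rho : R) (z : C) : C :=
  if Rle_dec (Cmod z) rho then z else (RtoC (rho / Cmod z) * z)%C.

Lemma retract_id (rho : R) (z : C) : Cmod z <= rho -> retract rho z = z.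
Proof. intro H. unfold retract. destruct Rle_dec; [reflexivity | contradiction]. Qed.

(** The normal-cone description of the nearest point of the disk: the displacement from it
    is an outward multiple of it, and vanishes unless it lies on the bounding circle. *)
Lemma retract_spec (rho : R) (z : C) : 0 < rho ->
  Cmod (retract rho z) <= rho /\
  exists s, 0 <= s /\ z = (RtoC (1 + s) * retract rho z)%C /\
    s * (rho ^ 2 - Cmod (retract rho z) ^ 2) = 0.
Proof.
  intro Hrho. unfold retract. destruct Rle_dec as [H | H].
  - split; [assumption |]. exists 0. split; [lra |].
    split; [rewrite Rplus_0_r; ring | ring].
  - apply Rnot_le_lt in H.
    assert (E : Cmod (RtoC (rho / Cmod z) * z) = rho).
    { rewrite Cmod_mult, Cmod_R, Rabs_pos_eq; [field; lra |].
      apply Rlt_le, Rdiv_lt_0_compat; lra. }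
    rewrite E. split; [lra |]. exists (Cmod z / rho - 1). split.
    { apply Rle_minus_r. rewrite Rplus_0_l. apply Rle_div_r; lra. }
    split; [| ring].
    rewrite Cmult_assoc, <- RtoC_mult.
    replace ((1 + (Cmod z / rho - 1)) * (rho / Cmod z)) with 1 by (field; lra).
    ring.
Qed.

Lemma retract_lipschitz (rho : R) (z1 z2 : C) : 0 < rho ->
  Cmod (retract rho z1 - retract rho z2) <= Cmod (z1 - z2).
Proof.
  intro Hrho.
  destruct (retract_spec rho z1 Hrho) as [H1 [s [Hs [E1 N1]]]].
  destruct (retract_spec rho z2 Hrho) as [H2 [t [Ht [E2 N2]]]].
  assert (Hsq : forall x y : R, 0 <= x <= y -> x ^ 2 <= y ^ 2)
    by (intros; apply pow_incr; assumption).
  pose proof (Hsq _ _ (conj (Cmod_ge_0 _) H1)) as S1.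
  pose proof (Hsq _ _ (conj (Cmod_ge_0 _) H2)) as S2.
  rewrite Cmod2_alt in S1, S2, N1, N2.
  replace (z1 - z2)%C
    with (RtoC (1 + s) * retract rho z1 - RtoC (1 + t) * retract rho z2)%C
    by (rewrite <- E1, <- E2; reflexivity).
  destruct (retract rho z1) as [p1 p2]. destruct (retract rho z2) as [q1 q2].
  apply Cmod_le_Cmod. unfold Re, Im in *. simpl in *.
  (* [p.(p - q)] is nonnegative as soon as [p] lies on the circle, which it does
     unless [s = 0] *)
  assert (0 <= rho ^ 2 - (p1 * q1 + p2 * q2)) as Hpq
    by (pose proof (pow2_ge_0 (p1 - q1)); pose proof (pow2_ge_0 (p2 - q2)); nra).
  pose proof (Rmult_le_pos s _ Hs Hpq).
  pose proof (Rmult_le_pos t _ Ht Hpq).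
  pose proof (pow2_ge_0 (s * p1 - t * q1)). pose proof (pow2_ge_0 (s * p2 - t * q2)).
  nra.
Qed.

(** * Logarithmic spirals as semiflows *)

(** The Dini bound is asked only below the level [M], because the flow is controlled only
    inside a disk; as [u] starts below [M] it never gets there. *)
Lemma dini_nonincreasing (u : R -> R) (M : R) :
  (forall t, continuity_pt u t) ->
  (forall t, 0 <= t -> u t < M -> forall eps, 0 < eps -> exists delta, 0 < delta /\
     forall s, 0 < s < delta -> u (t + s) <= u t + eps * s) ->
  u 0 < M -> forall T, 0 <= T -> u T <= u 0.
Proof.
  intros Hcont Hdini H0 T HT.
  assert (Hmain : forall eps, 0 < eps -> u 0 + eps * T < M -> u T <= u 0 + eps * T).
  { intros eps Heps HM.
    (* [E] is closed by continuity and can be prolonged to the right by the Dini bound *)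
    set (E := fun t => 0 <= t <= T /\ forall r, 0 <= r <= t -> u r <= u 0 + eps * r).
    assert (E0 : E 0).
    { split; [lra |]. intros r Hr. replace r with 0 by lra. lra. }
    destruct (completeness E) as [t1 [Hub Hlub]].
    { exists T. intros t [Ht _]. lra. }
    { exists 0. exact E0. }
    assert (Ht1 : 0 <= t1 <= T).
    { split; [apply Hub; exact E0 |]. apply Hlub. intros t [Ht _]. lra. }
    assert (Hbelow : forall r, 0 <= r < t1 -> u r <= u 0 + eps * r).
    { intros r Hr. apply Rnot_lt_le. intro Hlt.
      assert (t1 <= r); [| lra]. apply Hlub. intros t [Ht Hu].
      apply Rnot_lt_le. intro. specialize (Hu r ltac:(lra)). lra. }
    assert (Hat : u t1 <= u 0 + eps * t1).
    { apply Rnot_lt_le. intro Hlt.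
      destruct (Rle_lt_or_eq_dec 0 t1 ltac:(lra)) as [Hpos | Heq];
        [| rewrite <- Heq in Hlt; lra].
      destruct (Hcont t1 (u t1 - (u 0 + eps * t1)) ltac:(lra)) as [d [Hd Hc]].
      set (r := t1 - Rmin (d / 2) t1).
      assert (0 < Rmin (d / 2) t1) by (apply Rmin_pos; lra).
      pose proof (Rmin_l (d / 2) t1). pose proof (Rmin_r (d / 2) t1).
      assert (Hr : 0 <= r < t1) by (unfold r; lra).
      specialize (Hbelow r Hr).
      assert (Hdist : Rabs (u r - u t1) < u t1 - (u 0 + eps * t1)).
      { apply Hc. split; [split; [exact I | lra] |].
        simpl. unfold Rdist. apply Rabs_def1; unfold r in *; lra. }
      apply Rabs_def2 in Hdist. nra. }
    assert (Et1 : E t1).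
    { split; [assumption |]. intros r Hr.
      destruct (Rle_lt_or_eq_dec r t1 ltac:(lra)) as [Hlt | ->]; [| assumption].
      apply Hbelow. lra. }
    destruct (Rle_lt_or_eq_dec t1 T ltac:(lra)) as [Hlt | <-]; [| assumption].
    exfalso.
    destruct (Hdini t1 ltac:(lra) ltac:(nra) eps Heps) as [d [Hd Hs]].
    set (s0 := Rmin (d / 2) (T - t1)).
    assert (0 < s0) by (apply Rmin_pos; lra).
    pose proof (Rmin_l (d / 2) (T - t1)) as Hs1.
    pose proof (Rmin_r (d / 2) (T - t1)) as Hs2. fold s0 in Hs1, Hs2.
    assert (t1 + s0 <= t1); [| lra].
    apply Hub. split; [lra |]. intros r Hr.
    destruct (Rle_lt_dec r t1) as [Hle | Hgt]; [apply Et1; lra |].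
    specialize (Hs (r - t1) ltac:(lra)).
    replace (t1 + (r - t1)) with r in Hs by ring. nra. }
  apply Rnot_lt_le. intro Hlt.
  (* [eps] so small that [u 0 + eps * T] lies below both [u T] and [M] *)
  set (g := Rmin (u T - u 0) (M - u 0)).
  assert (Hg : 0 < g) by (apply Rmin_pos; lra).
  pose proof (Rmin_l (u T - u 0) (M - u 0)) as Hg1.
  pose proof (Rmin_r (u T - u 0) (M - u 0)) as Hg2. fold g in Hg1, Hg2.
  assert (He : g / (2 * (T + 1)) * T < g).
  { assert (g / (2 * (T + 1)) * (T + 1) = g / 2) by (field; lra).
    assert (0 < g / (2 * (T + 1))) by (apply Rdiv_lt_0_compat; lra). nra. }
  specialize (Hmain (g / (2 * (T + 1))) ltac:(apply Rdiv_lt_0_compat; lra) ltac:(lra)).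
  lra.
Qed.

Lemma Cexp_add (x y : C) : Cexp (x + y) = (Cexp x * Cexp y)%C.
Proof.
  destruct x as [a b], y as [c d]. unfold Cexp, Cmult, Cplus; simpl.
  rewrite exp_plus, cos_plus, sin_plus. f_equal; ring.
Qed.

Lemma Cexp_0 : Cexp (RtoC 0) = RtoC 1.
Proof.
  unfold Cexp, RtoC; simpl. rewrite exp_0, cos_0, sin_0. f_equal; ring.
Qed.

Lemma Cexp_neg_ln (s : R) : 0 < s -> Cexp (- (1 * RtoC (ln s))) = RtoC (/ s).
Proof.
  intro Hs. replace (- (1 * RtoC (ln s)))%C with (RtoC (- ln s))
    by (apply injective_projections; simpl; ring).
  unfold Cexp, RtoC; simpl. rewrite exp_Ropp, exp_ln, cos_0, sin_0 by assumption.
  f_equal; ring.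
Qed.

Lemma derivable_pt_lim_expansion (x : R -> R) (a : R) :
  derivable_pt_lim x 0 a -> forall eps, 0 < eps -> exists d, 0 < d /\
    forall s, Rabs s < d -> Rabs (x s - x 0 - a * s) <= eps * Rabs s.
Proof.
  intros Hx eps Heps. destruct (Hx eps Heps) as [d Hd].
  exists d. split; [apply cond_pos |]. intros s Hs.
  destruct (Req_dec s 0) as [-> | Hs0].
  - replace (x 0 - x 0 - a * 0) with 0 by ring. rewrite Rabs_R0. lra.
  - specialize (Hd s Hs0 Hs). rewrite Rplus_0_l in Hd.
    replace (x s - x 0 - a * s) with (((x s - x 0) / s - a) * s) by (field; assumption).
    rewrite Rabs_mult. apply Rmult_le_compat_r; [apply Rabs_pos | lra].
Qed.

Lemma Cexp_expansion (lam : C) (eps : R) : 0 < eps -> exists d, 0 < d /\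
  forall s, Rabs s < d ->
    Cmod (Cexp (lam * RtoC s) - 1 - lam * RtoC s) <= eps * Rabs s.
Proof.
  intro Heps. destruct lam as [a b].
  destruct (derivable_pt_lim_expansion (fun s => exp (a * s) * cos (b * s)) a)
    with (eps := eps / 2) as [d1 [Hd1 H1]]; [| lra |].
  { apply is_derive_Reals. auto_derive; [exact I |].
    rewrite !Rmult_0_r, exp_0, cos_0, sin_0. ring. }
  destruct (derivable_pt_lim_expansion (fun s => exp (a * s) * sin (b * s)) b)
    with (eps := eps / 2) as [d2 [Hd2 H2]]; [| lra |].
  { apply is_derive_Reals. auto_derive; [exact I |].
    rewrite !Rmult_0_r, exp_0, cos_0, sin_0. ring. }
  exists (Rmin d1 d2). split; [apply Rmin_pos; assumption |]. intros s Hs.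
  specialize (H1 s (Rlt_le_trans _ _ _ Hs (Rmin_l _ _))).
  specialize (H2 s (Rlt_le_trans _ _ _ Hs (Rmin_r _ _))). simpl in H1, H2.
  rewrite !Rmult_0_r, exp_0, cos_0 in H1. rewrite !Rmult_0_r, exp_0, sin_0 in H2.
  eapply Rle_trans; [apply Cmod_le_abs_sum |].
  replace (Re (Cexp ((a, b) * RtoC s) - 1 - (a, b) * RtoC s))
    with (exp (a * s) * cos (b * s) - 1 * 1 - a * s).
  2:{ unfold Cexp; simpl. replace (a * s - b * 0) with (a * s) by ring.
      replace (a * 0 + b * s) with (b * s) by ring. ring. }
  replace (Im (Cexp ((a, b) * RtoC s) - 1 - (a, b) * RtoC s))
    with (exp (a * s) * sin (b * s) - 1 * 0 - b * s).
  2:{ unfold Cexp; simpl. replace (a * s - b * 0) with (a * s) by ring.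
      replace (a * 0 + b * s) with (b * s) by ring. ring. }
  lra.
Qed.

Lemma spiral_expansion (lam w0 : C) (t eps : R) : 0 < eps -> exists d, 0 < d /\
  forall s, Rabs s < d ->
    Cmod (w0 * Cexp (- (lam * RtoC (t + s))) - w0 * Cexp (- (lam * RtoC t))
          + lam * RtoC s * (w0 * Cexp (- (lam * RtoC t)))) <= eps * Rabs s.
Proof.
  intro Heps. set (w := (w0 * Cexp (- (lam * RtoC t)))%C).
  pose proof (Cmod_ge_0 w) as Hw.
  destruct (Cexp_expansion (- lam) (eps / (Cmod w + 1))) as [d [Hd H]];
    [apply Rdiv_lt_0_compat; lra |].
  exists d. split; [assumption |]. intros s Hs. specialize (H s Hs).
  replace (- (lam * RtoC (t + s)))%C with (- (lam * RtoC t) + - lam * RtoC s)%C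
    by (rewrite RtoC_plus; ring).
  rewrite Cexp_add.
  replace (w0 * (Cexp (- (lam * RtoC t)) * Cexp (- lam * RtoC s)) - w + lam * RtoC s * w)%C
    with (w * (Cexp (- lam * RtoC s) - 1 - - lam * RtoC s))%C by (unfold w; ring).
  rewrite Cmod_mult.
  apply Rle_trans with (Cmod w * (eps / (Cmod w + 1) * Rabs s)).
  - apply Rmult_le_compat_l; assumption.
  - pose proof (Rabs_pos s).
    assert (eps / (Cmod w + 1) * (Cmod w + 1) = eps) by (field; lra).
    assert (0 < eps / (Cmod w + 1)) by (apply Rdiv_lt_0_compat; lra).
    nra.
Qed.

(** The curve [zeta t = G (w t)] lifts the spiral [w t] through [f], and solves
    [p * zeta' + q * conj zeta' = - lam * w]. Solving this linear system shows that
    [(|p|^2 - |q|^2) * Re (conj zeta * zeta')] equals [- Re (lam * w * conj (Euler f))],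
    where [Euler f = z * p - conj z * q]; so [|zeta|] does not increase. *)
Lemma spiral_flow_invariance (f G : C -> C) (K r : R) (lam w0 : C) :
  0 <= K -> 0 < r ->
  (forall w1 w2, Cmod (G w1 - G w2) <= K * Cmod (w1 - w2)) ->
  (forall w, Cmod (G w) < r -> f (G w) = w) ->
  (forall z, Cmod z < r -> exists p q, wirtinger f z p q /\ Cmod q < Cmod p /\
     0 <= Re (lam * f z * Cconj (z * p - Cconj z * q))) ->
  Cmod (G w0) < r -> forall T, 0 <= T ->
  Cmod (G (w0 * Cexp (- (lam * RtoC T)))%C) <= Cmod (G w0).
Proof.
  intros HK Hr HG HfG Hf Hw0 T HT.
  set (w := fun t : R => (w0 * Cexp (- (lam * RtoC t)))%C).
  set (zeta := fun t => G (w t)).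
  assert (Ew0 : w 0 = w0).
  { unfold w. replace (- (lam * RtoC 0))%C with (RtoC 0) by ring. rewrite Cexp_0. ring. }
  assert (Hcz : forall t, continuity_pt (fun t => Cmod (zeta t)) t).
  { intros t eps Heps. destruct (spiral_expansion lam w0 t 1 Rlt_0_1) as [d [Hd Hexp]].
    set (L := K * (1 + Cmod (lam * w t))).
    assert (HL : 0 <= L).
    { apply Rmult_le_pos; [assumption |]. pose proof (Cmod_ge_0 (lam * w t)). lra. }
    exists (Rmin d (eps / (L + 1))). split.
    { apply Rmin_pos; [assumption |]. apply Rdiv_lt_0_compat; lra. }
    simpl. unfold Rdist. intros x [_ Hx].
    assert (Hx1 := Rlt_le_trans _ _ _ Hx (Rmin_l _ _)).
    assert (Hx2 := Rlt_le_trans _ _ _ Hx (Rmin_r _ _)).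
    apply Rlt_div_r in Hx2; [| lra].
    specialize (Hexp (x - t) Hx1). replace (t + (x - t)) with x in Hexp by ring.
    fold (w x) (w t) in Hexp.
    assert (Hwx : Cmod (w x - w t) <= (1 + Cmod (lam * w t)) * Rabs (x - t)).
    { replace (w x - w t)%C with ((w x - w t + lam * RtoC (x - t) * w t)
        - lam * w t * RtoC (x - t))%C by ring.
      eapply Rle_trans; [apply Cmod_triangle_minus |].
      rewrite (Cmod_mult (lam * w t)), Cmod_R. lra. }
    assert (HGx : Cmod (zeta x - zeta t) <= L * Rabs (x - t)).
    { eapply Rle_trans; [apply HG |]. unfold L. rewrite Rmult_assoc.
      apply Rmult_le_compat_l; assumption. }
    pose proof (Rabs_pos (x - t)).
    pose proof (Cmod_triangle_inv (zeta x - zeta t) (zeta t)) as T1.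
    pose proof (Cmod_triangle (zeta x - zeta t) (zeta t)) as T2.
    pose proof (Cmod_triangle_minus (zeta x) (zeta x - zeta t)) as T3.
    replace (zeta x - zeta t + zeta t)%C with (zeta x) in T2 by ring.
    replace (zeta x - (zeta x - zeta t))%C with (zeta t) in T3 by ring.
    apply Rabs_def1; nra. }
  assert (Hgoal : Cmod (zeta T) ^ 2 <= Cmod (zeta 0) ^ 2).
  { apply (dini_nonincreasing (fun t => Cmod (zeta t) ^ 2) (r ^ 2)); [| | | assumption].
    - intro t. simpl.
      apply (continuity_pt_mult (fun t => Cmod (zeta t)) (fun t => Cmod (zeta t) * 1));
        [apply Hcz |].
      apply (continuity_pt_mult (fun t => Cmod (zeta t)) (fun _ => 1)); [apply Hcz |].
      apply continuity_pt_const. intros ? ?; reflexivity.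
    - intros t Ht Hlt eps Heps.
      assert (Hz : Cmod (zeta t) < r).
      { pose proof (Cmod_ge_0 (zeta t)). nra. }
      destruct (Hf _ Hz) as [p [q [Hpq [Hqp Hre]]]].
      assert (Hfz : f (zeta t) = w t) by (apply HfG; exact Hz). rewrite Hfz in Hre.
      set (z := zeta t) in *.
      set (F := (z * p - Cconj z * q)%C) in *.
      set (J := Cmod p ^ 2 - Cmod q ^ 2).
      assert (HJ : 0 < J) by (unfold J; pose proof (Cmod_ge_0 q); nra).
      set (D := Cmod F + 1).
      assert (HD : 0 < D) by (unfold D; pose proof (Cmod_ge_0 F); lra).
      set (L := K * (1 + Cmod (lam * w t))).
      assert (HL : 0 <= L).
      { apply Rmult_le_pos; [assumption |]. pose proof (Cmod_ge_0 (lam * w t)). lra. }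
      (* [L] is a local Lipschitz constant of [zeta]; with these error levels the
         first-order error is at most [eps / 2 * s] *)
      set (e1 := J * eps / (8 * D * (L + 1))).
      set (e2 := Rmin 1 (J * eps / (8 * D))).
      assert (HJe : 0 < J * eps) by (apply Rmult_lt_0_compat; assumption).
      assert (He1 : 0 < e1).
      { apply Rdiv_lt_0_compat; [assumption |]. apply Rmult_lt_0_compat; lra. }
      assert (He2 : 0 < e2).
      { apply Rmin_pos; [lra |]. apply Rdiv_lt_0_compat; lra. }
      destruct (Hpq e1 He1) as [d1 [Hd1 Hw1]].
      destruct (spiral_expansion lam w0 t e2 He2) as [d2 [Hd2 Hw2]].
      destruct (Hcz t (r - Cmod z)) as [d3 [Hd3 Hc3]]; [fold z; lra |].
      set (d4 := d1 / (L + 1)). set (d5 := eps / (2 * (L ^ 2 + 1))).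
      assert (Hd4 : 0 < d4) by (apply Rdiv_lt_0_compat; lra).
      pose proof (pow2_ge_0 L) as HL2.
      assert (Hd5 : 0 < d5) by (apply Rdiv_lt_0_compat; lra).
      exists (Rmin (Rmin d2 d3) (Rmin d4 d5)).
      split; [repeat apply Rmin_pos; assumption |].
      intros s [Hs Hsd].
      assert (Hsd2 : s < d2) by (eapply Rlt_le_trans; [exact Hsd |];
        eapply Rle_trans; [apply Rmin_l | apply Rmin_l]).
      assert (Hsd3 : s < d3) by (eapply Rlt_le_trans; [exact Hsd |];
        eapply Rle_trans; [apply Rmin_l | apply Rmin_r]).
      assert (Hsd4 : s < d4) by (eapply Rlt_le_trans; [exact Hsd |];
        eapply Rle_trans; [apply Rmin_r | apply Rmin_l]).
      assert (Hsd5 : s < d5) by (eapply Rlt_le_trans; [exact Hsd |];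
        eapply Rle_trans; [apply Rmin_r | apply Rmin_r]).
      apply Rlt_div_r in Hsd4; [| lra]. apply Rlt_div_r in Hsd5; [| lra].
      assert (Hz' : Cmod (zeta (t + s)%R) < r).
      { assert (Hdist : Rabs (Cmod (zeta (t + s)%R) - Cmod z) < r - Cmod z).
        { apply Hc3. split; [split; [exact I | lra] |].
          simpl. unfold Rdist. replace (t + s - t) with s by ring.
          rewrite Rabs_pos_eq; lra. }
        apply Rabs_def2 in Hdist. lra. }
      assert (Hfz' : f (zeta (t + s)%R) = w (t + s)%R) by (apply HfG; exact Hz').
      specialize (Hw2 s ltac:(rewrite Rabs_pos_eq; lra)).
      fold (w (t + s)%R) (w t) in Hw2. rewrite Rabs_pos_eq in Hw2 by lra.
      set (k := (zeta (t + s)%R - z)%C).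
      assert (Hk : Cmod k <= L * s).
      { eapply Rle_trans; [apply HG |]. unfold L. rewrite Rmult_assoc.
        apply Rmult_le_compat_l; [assumption |].
        replace (w (t + s)%R - w t)%C with ((w (t + s)%R - w t + lam * RtoC s * w t)
          - lam * w t * RtoC s)%C by ring.
        eapply Rle_trans; [apply Cmod_triangle_minus |].
        rewrite (Cmod_mult (lam * w t)), Cmod_R, Rabs_pos_eq by lra.
        assert (e2 <= 1) by apply Rmin_l. nra. }
      specialize (Hw1 k ltac:(nra)).
      replace (z + k)%C with (zeta (t + s)%R) in Hw1 by (unfold k; ring).
      rewrite Hfz, Hfz' in Hw1.
      set (X := (p * k + q * Cconj k)%C) in *.
      set (E := (X + lam * RtoC s * w t)%C).
      assert (HE : Cmod E <= (e2 + e1 * L) * s).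
      { unfold E. replace (X + lam * RtoC s * w t)%C with
          ((w (t + s)%R - w t + lam * RtoC s * w t) - (w (t + s)%R - w t - X))%C by ring.
        eapply Rle_trans; [apply Cmod_triangle_minus |].
        assert (e1 * Cmod k <= e1 * (L * s)) by (apply Rmult_le_compat_l; lra). lra. }
      (* solving [X = p k + q conj k] for the radial component of [k] *)
      assert (HJk : J * Re (Cconj z * k) = Re (X * Cconj F)).
      { unfold J. rewrite !Cmod2_alt. unfold X, F.
        destruct z as [z1 z2], k as [k1 k2], p as [p1 p2], q as [q1 q2].
        unfold Re, Im; simpl. ring. }
      assert (HXF : Re (X * Cconj F) <= Cmod E * Cmod F).
      { replace (X * Cconj F)%C
          with (E * Cconj F - RtoC s * (lam * w t * Cconj F))%C by (unfold E; ring).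
        pose proof (Rle_trans _ _ _ (Rle_abs _) (re_le_Cmod (E * Cconj F))) as HR.
        rewrite Cmod_mult, Cmod_conj in HR.
        replace (Re (E * Cconj F - RtoC s * (lam * w t * Cconj F)))
          with (Re (E * Cconj F) - s * Re (lam * w t * Cconj F)) by (simpl; ring).
        nra. }
      assert (Hnorm : Cmod (zeta (t + s)%R) ^ 2
                      = Cmod z ^ 2 + 2 * Re (Cconj z * k) + Cmod k ^ 2).
      { replace (zeta (t + s)%R) with (z + k)%C by (unfold k; ring).
        rewrite !Cmod2_alt. destruct z as [z1 z2], k as [k1 k2]. simpl. ring. }
      rewrite Hnorm.
      assert (Hk2 : Cmod k ^ 2 <= eps / 2 * s).
      { apply Rle_trans with ((L * s) ^ 2).
        - apply pow_incr. split; [apply Cmod_ge_0 | assumption].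
        - assert (s * L ^ 2 <= eps / 2) by nra. nra. }
      assert (Hbound : (e2 + e1 * L) * Cmod F <= J * (eps / 4)).
      { assert (A2 : e2 * D <= J * eps / 8).
        { apply Rle_trans with (J * eps / (8 * D) * D).
          - apply Rmult_le_compat_r; [lra | apply Rmin_r].
          - right. field. lra. }
        assert (A1 : e1 * (L + 1) * D = J * eps / 8) by (unfold e1; field; lra).
        pose proof (Cmod_ge_0 F).
        assert (e1 * L * D <= e1 * (L + 1) * D) by (apply Rmult_le_compat_r; nra).
        assert (0 <= e1 * L) by nra. unfold D in *. nra. }
      assert (HJ2 : J * Re (Cconj z * k) <= J * (eps / 4 * s)).
      { rewrite HJk. eapply Rle_trans; [exact HXF |].
        apply Rle_trans with ((e2 + e1 * L) * s * Cmod F).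
        - apply Rmult_le_compat_r; [apply Cmod_ge_0 | assumption].
        - nra. }
      apply Rmult_le_reg_l in HJ2; [| assumption]. lra.
    - unfold zeta. rewrite Ew0. pose proof (Cmod_ge_0 (G w0)). nra. }
  unfold zeta in Hgoal. rewrite Ew0 in Hgoal. unfold w in Hgoal.
  pose proof (Cmod_ge_0 (G (w0 * Cexp (- (lam * RtoC T)))%C)).
  pose proof (Cmod_ge_0 (G w0)).
  apply Rnot_lt_le. intro. nra.
Qed.

(** Two half-plane conditions at the boundary angles of the sector of order [alpha] suffice:
    they make the image invariant under the two spirals, and their sum makes it starlike.
    The Lipschitz condition is asked on a slightly larger disk, of radius [rho], where the
    inverse [G] of the extended map still agrees with the inverse of [f]. *)
Lemma strongly_starlike_of_halfplanes (alpha : R) (f : C -> C) (r rho L : R) :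
  0 < tan (PI * alpha / 2) -> 0 < r < rho -> 0 <= L < 1 -> f (RtoC 0) = RtoC 0 ->
  (forall z1 z2, Cmod z1 <= rho -> Cmod z2 <= rho ->
     Cmod ((f z1 - z1) - (f z2 - z2)) <= L * Cmod (z1 - z2)) ->
  (forall z, Cmod z < r -> exists p q, wirtinger f z p q /\ Cmod q < Cmod p /\
     0 <= Re ((RtoC (tan (PI * alpha / 2)) - Ci) * f z * Cconj (z * p - Cconj z * q)) /\
     0 <= Re ((RtoC (tan (PI * alpha / 2)) + Ci) * f z * Cconj (z * p - Cconj z * q))) ->
  strongly_starlike alpha (image f (disk r)).
Proof.
  set (tau := tan (PI * alpha / 2)).
  intros Htau Hr HL Hf0 Hlip Hhalf.
  destruct (lipschitz_perturbation_inverse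
              (fun z => f (retract rho z) - retract rho z)%C L HL) as [G [HfG [HG HGf]]].
  { intros z1 z2.
    destruct (retract_spec rho z1 ltac:(lra)) as [R1 _].
    destruct (retract_spec rho z2 ltac:(lra)) as [R2 _].
    eapply Rle_trans; [apply (Hlip _ _ R1 R2) |].
    apply Rmult_le_compat_l; [lra |]. apply retract_lipschitz. lra. }
  assert (HfG' : forall w, Cmod (G w) < r -> f (G w) = w).
  { intros w Hw. rewrite <- (HfG w) at 2. rewrite retract_id by lra. ring. }
  assert (HGf' : forall z, Cmod z < r -> G (f z) = z).
  { intros z Hz. rewrite <- (HGf z) at 2. rewrite retract_id by lra. f_equal. ring. }
  assert (Him : forall w, image f (disk r) w <-> Cmod (G w) < r).
  { intro w. split.
    - intros [z [Hz <-]]. rewrite HGf'; assumption.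
    - intro Hw. exists (G w). split; [exact Hw | apply HfG'; exact Hw]. }
  assert (HK : 0 < / (1 - L)) by (apply Rinv_0_lt_compat; lra).
  split; [split; [| split] |].
  - apply Cmod_open. intros x Hx. apply Him in Hx.
    exists ((r - Cmod (G x)) * (1 - L)). split; [nra |].
    intros y Hy. apply Him.
    pose proof (Cmod_triangle (G y - G x) (G x)) as HT.
    replace (G y - G x + G x)%C with (G y) in HT by ring.
    specialize (HG y x).
    assert (/ (1 - L) * Cmod (y - x) < r - Cmod (G x)); [| lra].
    apply Rmult_lt_reg_l with (1 - L); [lra |].
    rewrite <- Rmult_assoc, Rinv_r by lra. lra.
  - apply connected_of_paths. intros w1 w2 [z1 [Hz1 <-]] [z2 [Hz2 <-]].
    unfold disk in Hz1, Hz2.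
    set (line := fun t => (z1 + RtoC t * (z2 - z1))%C).
    assert (Hline : forall t, 0 <= t <= 1 -> Cmod (line t) < r).
    { intros t Ht. unfold line.
      replace (z1 + RtoC t * (z2 - z1))%C with (RtoC (1 - t) * z1 + RtoC t * z2)%C
        by (rewrite RtoC_minus; ring).
      eapply Rle_lt_trans; [apply Cmod_triangle |].
      rewrite !Cmod_mult, !Cmod_R, !Rabs_pos_eq by lra.
      pose proof (Rmax_l (Cmod z1) (Cmod z2)). pose proof (Rmax_r (Cmod z1) (Cmod z2)).
      pose proof (Rmax_lub_lt _ _ _ Hz1 Hz2).
      assert ((1 - t) * Cmod z1 <= (1 - t) * Rmax (Cmod z1) (Cmod z2))
        by (apply Rmult_le_compat_l; lra).
      assert (t * Cmod z2 <= t * Rmax (Cmod z1) (Cmod z2))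
        by (apply Rmult_le_compat_l; lra).
      lra. }
    exists (fun t => f (line t)), ((1 + L) * Cmod (z2 - z1)).
    split; [unfold line; f_equal; ring |]. split; [unfold line; f_equal; ring |]. split.
    + intros t Ht. exists (line t). split; [apply Hline; assumption | reflexivity].
    + intros s t Hs Ht.
      assert (E : Cmod (line s - line t) = Cmod (z2 - z1) * Rabs (s - t)).
      { unfold line. rewrite <- Cmod_R, <- Cmod_mult. f_equal. rewrite RtoC_minus. ring. }
      pose proof (Hlip (line s) (line t) (Rlt_le _ _ (Rlt_trans _ _ _ (Hline s Hs) (proj2 Hr)))
        (Rlt_le _ _ (Rlt_trans _ _ _ (Hline t Ht) (proj2 Hr)))) as H.
      replace (f (line s) - f (line t))%C with ((f (line s) - line s - (f (line t) - line t))
        + (line s - line t))%C by ring.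
      eapply Rle_trans; [apply Cmod_triangle |]. rewrite E in H |- *. lra.
  - exists (f (RtoC 0)), (RtoC 0). split; [| reflexivity]. unfold disk. rewrite Cmod_0. lra.
  - assert (Hflow : forall lam, lam = RtoC 1 \/ lam = (RtoC tau - Ci)%C \/ lam = (RtoC tau + Ci)%C ->
      forall w0, image f (disk r) w0 -> forall t, 0 <= t ->
      image f (disk r) (w0 * Cexp (- (lam * RtoC t)))%C).
    { intros lam Hlam w0 Hw0 t Ht. apply Him. apply Him in Hw0.
      eapply Rle_lt_trans; [| exact Hw0].
      apply spiral_flow_invariance with (f := f) (K := / (1 - L)) (r := r);
        [lra | lra | exact HG | exact HfG' | | exact Hw0 | exact Ht].
      intros z Hz. destruct (Hhalf z Hz) as [p [q [Hpq [Hqp [Hm Hp]]]]].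
      exists p, q. split; [assumption |]. split; [assumption |].
      destruct Hlam as [-> | [-> | ->]]; [| exact Hm | exact Hp].
      (* the half-plane for [1] contains the intersection of the other two, since
         [(tau - Ci) + (tau + Ci) = 2 tau] *)
      revert Hm Hp. generalize (f z) (z * p - Cconj z * q)%C. intros [a b] [c d].
      simpl. intros. nra. }
    intros w0 Hw0 w Hw.
    destruct (jordan_domain_radial _ _ Hw) as [-> | [s [Hs Hsp]]].
    { exists (RtoC 0). split; [unfold disk; rewrite Cmod_0; lra |]. rewrite Hf0. ring. }
    assert (Hsw : image f (disk r) (w0 * (RtoC s * w))%C).
    { destruct Hsp as [[theta [Htheta E]] | [theta [Htheta E]]]; rewrite E; fold tau.
      - replace ((- RtoC tau + Ci) * RtoC theta)%C
          with (- ((RtoC tau - Ci) * RtoC theta))%C by ring.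
        apply Hflow; [auto | assumption | lra].
      - replace ((RtoC tau + Ci) * RtoC theta)%C
          with (- ((RtoC tau + Ci) * RtoC (- theta)))%C by (rewrite RtoC_opp; ring).
        apply Hflow; [auto | assumption | lra]. }
    (* [w = sigma / s] with [sigma] on a spiral: flow along the spiral to [w0 sigma], then
       radially during the time [ln s] *)
    assert (Hln : 0 <= ln s).
    { rewrite <- ln_1. apply ln_le; lra. }
    pose proof (Hflow (RtoC 1) (or_introl eq_refl) _ Hsw (ln s) Hln) as H.
    rewrite Cexp_neg_ln in H by lra.
    replace (w0 * w)%C with (w0 * (RtoC s * w) * RtoC (/ s))%C; [exact H |].
    replace (w0 * (RtoC s * w) * RtoC (/ s))%C with (w0 * w * (RtoC s * RtoC (/ s)))%C by ring.
    rewrite <- RtoC_mult, Rinv_r by lra. ring.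
Qed.

(** * Wirtinger derivatives and partial derivatives *)

Lemma wirtinger_derivatives (f : C -> C) (z p q : C) :
  wirtinger f z p q -> Cdz f z = p /\ Cdzbar f z = q.
Proof.
  intro Hf.
  (* one computation for the four partial derivatives: [P] is [Re] or [Im], and [v] is
     [1] or [Ci] *)
  assert (Hdir : forall (v : C) (gamma : R -> C) (t0 : R) (P : C -> R), Cmod v = 1 ->
    (forall t, gamma (t0 + t) = (z + RtoC t * v)%C) ->
    (forall a b, P (a - b)%C = P a - P b) -> (forall t a, P (RtoC t * a)%C = t * P a) ->
    (forall a, Rabs (P a) <= Cmod a) ->
    Derive (fun t => P (f (gamma t))) t0 = P (p * v + q * Cconj v)%C).
  { intros v gamma t0 P Hv Hgamma Pminus Pscal Pabs.
    apply is_derive_unique, is_derive_Reals. intros eps Heps.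
    destruct (Hf (eps / 2) ltac:(lra)) as [d [Hd H]].
    exists (mkposreal d Hd). intros t Ht Htd. simpl in Htd.
    specialize (H (RtoC t * v)%C). rewrite Cmod_mult, Cmod_R, Hv, Rmult_1_r in H.
    specialize (H Htd).
    replace (gamma t0) with z by (rewrite <- (Rplus_0_r t0), Hgamma; ring).
    rewrite Hgamma.
    apply Rabs_pos_lt in Ht as Ht'.
    apply Rmult_lt_reg_r with (Rabs t); [assumption |].
    rewrite <- Rabs_mult.
    replace (((P (f (z + RtoC t * v)%C) - P (f z)) / t - P (p * v + q * Cconj v)%C) * t)
      with (P (f (z + RtoC t * v) - f z - RtoC t * (p * v + q * Cconj v))%C)
      by (rewrite !Pminus, Pscal; field; assumption).
    eapply Rle_lt_trans; [apply Pabs |].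
    replace (f (z + t * v) - f z - t * (p * v + q * Cconj v))%C
      with (f (z + t * v) - f z - (p * (t * v) + q * Cconj (t * v)))%C.
    - eapply Rle_lt_trans; [exact H |]. nra.
    - rewrite Cmult_conj. replace (Cconj t) with (RtoC t)
        by (apply injective_projections; simpl; ring). ring. }
  assert (Re_abs : forall a, Rabs (Re a) <= Cmod a) by exact re_le_Cmod.
  assert (Im_abs : forall a, Rabs (Im a) <= Cmod a)
    by (intro a; eapply Rle_trans; [apply Rmax_r | apply Rmax_Cmod]).
  assert (Hx : Cdx f z = (p + q)%C).
  { unfold Cdx, partial_derive, re_part, im_part. simpl Derive_n.
    assert (Hg : forall t, (Re z + t, Im z) = (z + RtoC t * 1)%C)
      by (intro t; destruct z; apply injective_projections; simpl; ring).
    replace (p + q)%C with (p * 1 + q * Cconj 1)%C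
      by (apply injective_projections; simpl; ring).
    rewrite (Hdir (RtoC 1) (fun t => (t, Im z)) (Re z) Re);
      [| apply Cmod_1 | exact Hg | reflexivity | intros ? []; simpl; ring | exact Re_abs].
    rewrite (Hdir (RtoC 1) (fun t => (t, Im z)) (Re z) Im);
      [| apply Cmod_1 | exact Hg | reflexivity | intros ? []; simpl; ring | exact Im_abs].
    reflexivity. }
  assert (Hy : Cdy f z = (p * Ci + q * Cconj Ci)%C).
  { unfold Cdy, partial_derive, re_part, im_part. simpl Derive_n.
    assert (Hg : forall t, (Re z, Im z + t) = (z + RtoC t * Ci)%C)
      by (intro t; destruct z; apply injective_projections; simpl; ring).
    rewrite (Hdir Ci (fun t => (Re z, t)) (Im z) Re);
      [| apply Cmod_Ci | exact Hg | reflexivity | intros ? []; simpl; ring | exact Re_abs].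
    rewrite (Hdir Ci (fun t => (Re z, t)) (Im z) Im);
      [| apply Cmod_Ci | exact Hg | reflexivity | intros ? []; simpl; ring | exact Im_abs].
    reflexivity. }
  unfold Cdz, Cdzbar. rewrite Hx, Hy.
  split; apply injective_projections; simpl; field.
Qed.

Lemma wirtinger_id_plus (f H g : C -> C) (z l q : C) :
  Cmod z < 1 ->
  (forall z, disk 1 z -> f z = (z + H z + Cconj (g z))%C) ->
  wirtinger H z l (RtoC 0) -> wirtinger g z q (RtoC 0) ->
  wirtinger f z (1 + l)%C (Cconj q).
Proof.
  intros Hz Hf HH Hg eps Heps.
  destruct (HH (eps / 2) ltac:(lra)) as [d1 [Hd1 H1]].
  destruct (Hg (eps / 2) ltac:(lra)) as [d2 [Hd2 H2]].
  exists (Rmin (1 - Cmod z) (Rmin d1 d2)).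
  split; [repeat apply Rmin_pos; lra |]. intros k Hk.
  assert (Hk0 : Cmod k < 1 - Cmod z) by (eapply Rlt_le_trans; [exact Hk | apply Rmin_l]).
  assert (Hk1 : Cmod k < d1) by (eapply Rlt_le_trans; [exact Hk |];
    eapply Rle_trans; [apply Rmin_r | apply Rmin_l]).
  assert (Hk2 : Cmod k < d2) by (eapply Rlt_le_trans; [exact Hk |];
    eapply Rle_trans; [apply Rmin_r | apply Rmin_r]).
  specialize (H1 k Hk1). specialize (H2 k Hk2).
  rewrite (Hf z Hz), (Hf (z + k)%C)
    by (unfold disk; pose proof (Cmod_triangle z k); lra).
  replace (z + k + H (z + k)%C + Cconj (g (z + k)%C) - (z + H z + Cconj (g z))
           - ((1 + l) * k + Cconj q * Cconj k))%C
    with ((H (z + k)%C - H z - (l * k + 0 * Cconj k))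
          + Cconj (g (z + k)%C - g z - (q * k + 0 * Cconj k)))%C.
  - eapply Rle_trans; [apply Cmod_triangle |]. rewrite Cmod_conj. lra.
  - apply injective_projections; simpl; ring.
Qed.

(** * The weights *)

Lemma half_angle (alpha : R) : 0 < alpha < 1 ->
  let s := sin (PI * alpha / 2) in let c := cos (PI * alpha / 2) in
  0 < s /\ 0 < c /\ s ^ 2 + c ^ 2 = 1 /\
  cos (PI * alpha) = 1 - 2 * s ^ 2 /\ sin (PI * alpha) = 2 * s * c.
Proof.
  intros Ha s c. pose proof PI_RGT_0 as HPI.
  assert (0 < s) by (apply sin_gt_0; nra).
  assert (0 < c) by (apply cos_gt_0; nra).
  pose proof (sin2_cos2 (PI * alpha / 2)) as H1. fold s c in H1. unfold Rsqr in H1.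
  replace (PI * alpha) with (2 * (PI * alpha / 2)) by field.
  rewrite cos_2a_sin, sin_2a. fold s c.
  repeat split; try assumption; try ring. lra.
Qed.

(** With [e] the unit number of argument [pi * alpha], this is the triangle inequality
    [n |1 - e| <= |n - e| + (n - 1) |e|], as [|1 - e|] is twice the sine; squaring gives it
    directly. *)
Lemma coefA_lower (alpha : R) (n : nat) : 0 < alpha < 1 -> (1 <= n)%nat ->
  2 * sin (PI * alpha / 2) * INR n <= coefA alpha n.
Proof.
  intros Ha Hn. rewrite coefA_sqrt.
  destruct (half_angle alpha Ha) as [Hs [Hc [Hsc [Hcos _]]]].
  set (s := sin (PI * alpha / 2)) in *. set (c := cos (PI * alpha / 2)) in *.
  rewrite Hcos. apply le_INR in Hn. simpl in Hn. set (x := INR n) in *.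
  assert (Hs1 : s <= 1) by nra.
  destruct (Rle_lt_dec (2 * s * x - (x - 1)) 0) as [Hle | Hgt].
  - pose proof (sqrt_pos (x ^ 2 - 2 * x * (1 - 2 * s ^ 2) + 1)). lra.
  - assert (2 * s * x - (x - 1) <= sqrt (x ^ 2 - 2 * x * (1 - 2 * s ^ 2) + 1)); [| lra].
    rewrite <- (sqrt_pow2 (2 * s * x - (x - 1))) by lra. apply sqrt_le_1_alt.
    (* the difference of the two sides is [4 s x (x - 1) (1 - s)] *)
    assert (0 <= s * x * (x - 1) * (1 - s)) by (repeat apply Rmult_le_pos; lra). nra.
Qed.

(** This is [|n + e| >= n - 1]. The factor 2 exceeds the factor [2 * sin (PI * alpha / 2)] of
    [coefA_lower]; that gap keeps the Lipschitz constant of [f - id] below 1 even when the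
    linear coefficient of [g] carries the whole sum. *)
Lemma coefB_lower (alpha : R) (n : nat) : (1 <= n)%nat -> 2 * INR n <= coefB alpha n.
Proof.
  intros Hn. rewrite coefB_sqrt. apply le_INR in Hn. simpl in Hn. set (x := INR n) in *.
  assert (x - 1 <= sqrt (x ^ 2 + 2 * x * cos (PI * alpha) + 1)); [| lra].
  rewrite <- (sqrt_pow2 (x - 1)) by lra. apply sqrt_le_1_alt.
  pose proof (COS_bound (PI * alpha)). nra.
Qed.

(** Conjugating [e] changes nothing, so that one condition controls both half-planes. *)
Lemma coefA_unit (alpha : R) (e : C) (n : nat) :
  Cmod e = 1 -> Re e = cos (PI * alpha) ->
  coefA alpha n = INR n - 1 + Cmod (RtoC (INR n) - e).
Proof.
  intros He Hre.
  assert (Hcirc : Re e ^ 2 + Im e ^ 2 = 1) by (rewrite <- Cmod2_alt, He; ring).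
  rewrite coefA_sqrt, <- Hre. f_equal. unfold Cmod. f_equal.
  simpl in Hcirc |- *. unfold Re, Im in Hcirc |- *. lra.
Qed.

Lemma coefB_unit (alpha : R) (e : C) (n : nat) :
  Cmod e = 1 -> Re e = cos (PI * alpha) ->
  coefB alpha n = INR n + 1 + Cmod (RtoC (INR n) - - Cconj e).
Proof.
  intros He Hre.
  assert (Hcirc : Re e ^ 2 + Im e ^ 2 = 1) by (rewrite <- Cmod2_alt, He; ring).
  rewrite coefB_sqrt, <- Hre. f_equal. unfold Cmod. f_equal.
  simpl in Hcirc |- *. unfold Re, Im in Hcirc |- *. lra.
Qed.

(** [rho * Sa + Sb <= rho * Sa + k / 2 * (1 - Sa)] is a convex combination of [rho] and
    [k / 2], both less than 1. *)
Lemma convex_combination_lt_1 (rho k Sa Sb : R) :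
  0 <= rho < 1 -> 0 < k < 2 -> 0 <= Sa -> 0 <= Sb -> k * Sa + 2 * Sb <= k ->
  rho * Sa + Sb < 1.
Proof.
  intros Hrho Hk Ha Hb H.
  assert (H1 : Sb <= k / 2 * (1 - Sa)) by lra.
  assert (HSa : Sa <= 1) by nra.
  destruct (Rle_lt_or_eq_dec 0 Sa Ha) as [Hpos | Heq].
  - assert (rho * Sa < 1 * Sa) by (apply Rmult_lt_compat_r; lra).
    assert (k / 2 * (1 - Sa) <= 1 * (1 - Sa)) by (apply Rmult_le_compat_r; lra). lra.
  - rewrite <- Heq in *. lra.
Qed.

(** * Harmonic maps with small coefficients *)

(** Closer to [w] than to [e * w] means, when these have the same modulus, on the side of [w]
    of a line through the origin with normal [(1 - e) * w]. *)
Lemma halfplane_of_Cmod_le (F w e : C) :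
  Cmod e = 1 -> Cmod (F - w) <= Cmod (F - e * w) ->
  0 <= Re ((1 - e) * w * Cconj F).
Proof.
  intros He H.
  assert (H2 : Cmod (F - w) ^ 2 <= Cmod (F - e * w) ^ 2)
    by (apply pow_incr; split; [apply Cmod_ge_0 | exact H]).
  assert (Hew : Cmod (e * w) ^ 2 = Cmod w ^ 2) by (rewrite Cmod_mult, He; ring).
  rewrite !Cmod2_alt in H2, Hew.
  destruct F as [f1 f2], w as [w1 w2], e as [e1 e2]. simpl in *. nra.
Qed.

(** [z * (1 + l) - Cconj z * Cconj q] is the Euler operator applied to
    [f = id + H + conj g]. The four sums weigh the coefficients of [Df - f] and of
    [Df - e f - (1 - e) z]: for the antianalytic part the signs flip, whence the values
    [- 1] and [- Cconj e]. *)
Lemma euler_halfplane (c b : nat -> C) (H g : C -> C) (z l q e : C) (T1 T2 T3 T4 : R) :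
  Cmod z < 1 -> Cmod e = 1 ->
  c 0%nat = RtoC 0 -> b 0%nat = RtoC 0 ->
  (forall z, disk 1 z -> is_pseries c z (H z)) ->
  (forall z, disk 1 z -> is_pseries b z (g z)) ->
  is_series (fun n => (RtoC (INR n) * c n * z ^ pred n)%C) l ->
  is_series (fun n => (RtoC (INR n) * b n * z ^ pred n)%C) q ->
  is_series (fun n => Cmod (RtoC (INR n) - RtoC 1) * Cmod (c n)) T1 ->
  is_series (fun n => Cmod (RtoC (INR n) - e) * Cmod (c n)) T2 ->
  is_series (fun n => Cmod (RtoC (INR n) - - RtoC 1) * Cmod (b n)) T3 ->
  is_series (fun n => Cmod (RtoC (INR n) - - Cconj e) * Cmod (b n)) T4 ->
  T1 + T2 + T3 + T4 <= Cmod (1 - e) ->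
  0 <= Re ((1 - e) * (z + H z + Cconj (g z))
           * Cconj (z * (1 + l) - Cconj z * Cconj q)).
Proof.
  intros Hz He Hc0 Hb0 Hc Hb Hl Hq HT1 HT2 HT3 HT4 HT.
  apply halfplane_of_Cmod_le; [assumption |].
  pose proof (pseries_euler_bound _ _ _ _ _ _ Hz Hc0 Hc Hl HT1) as B1.
  pose proof (pseries_euler_bound _ _ _ _ _ _ Hz Hc0 Hc Hl HT2) as B2.
  pose proof (pseries_euler_bound _ _ _ _ _ _ Hz Hb0 Hb Hq HT3) as B3.
  pose proof (pseries_euler_bound _ _ _ _ _ _ Hz Hb0 Hb Hq HT4) as B4.
  apply Rle_trans with (Cmod z * (T1 + T3)).
  - replace (z * (1 + l) - Cconj z * Cconj q - (z + H z + Cconj (g z)))%C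
      with ((z * l - 1 * H z) - Cconj (z * q - - (1) * g z))%C
      by (apply injective_projections; simpl; ring).
    eapply Rle_trans; [apply Cmod_triangle_minus |]. rewrite Cmod_conj. lra.
  - replace (z * (1 + l) - Cconj z * Cconj q - e * (z + H z + Cconj (g z)))%C
      with ((1 - e) * z
            + ((z * l - e * H z) - Cconj (z * q - - Cconj e * g z)))%C
      by (apply injective_projections; simpl; ring).
    eapply Rle_trans; [| apply Cmod_triangle_inv].
    pose proof (Cmod_triangle_minus (z * l - e * H z)
                  (Cconj (z * q - - Cconj e * g z))) as HT'.
    rewrite Cmod_conj in HT'. rewrite Cmod_mult. pose proof (Cmod_ge_0 z).
    assert (Cmod z * (T1 + T2 + T3 + T4) <= Cmod z * Cmod (1 - e))
      by (apply Rmult_le_compat_l; assumption).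
    lra.
Qed.

(** The coefficients of [h z - z] when [h] is normalized. *)
Definition drop_linear (a : nat -> C) (n : nat) : C :=
  match n with O | 1%nat => RtoC 0 | _ => a n end.

Lemma drop_linear_pseries (a : nat -> C) (z l : C) :
  a 0%nat = RtoC 0 -> a 1%nat = RtoC 1 ->
  is_pseries a z l -> is_pseries (drop_linear a) z (l - z)%C.
Proof.
  intros H0 H1 H. apply (is_series_from _ 2).
  - intros [| [| n]] Hn; [| | lia];
      match goal with |- scal ?x _ = _ => exact (Cmult_0_r x) end.
  - pose proof (is_series_tail _ _ 1 H) as Ht.
    match type of Ht with is_series _ ?x => replace x with (l - z)%C in Ht; [exact Ht |] end.
    rewrite sum_Sn, sum_O, H0, H1.
    change (l - z = l - (1 * 0 + (z * 1) * 1))%C. ring.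
Qed.

Theorem theorem4p2 (alpha : R) (Halpha : 0 < alpha < 1)
  (f h g : C -> C) (a b : nat -> C)
  (Hf : class_H0 f)
  (Hh : analytic_on (disk 1) h) (Hg : analytic_on (disk 1) g)
  (Hfhg : forall z, disk 1 z -> f z = (h z + Cconj (g z))%C)
  (Ha0 : a 0%nat = RtoC 0) (Ha1 : a 1%nat = RtoC 1) (Hb0 : b 0%nat = RtoC 0)
  (Hha : forall z, disk 1 z -> is_pseries a z (h z))
  (Hgb : forall z, disk 1 z -> is_pseries b z (g z))
  (HexA : ex_series (fun k : nat => coefA alpha (k + 2) * Cmod (a (k + 2)%nat)))
  (HexB : ex_series (fun k : nat => coefB alpha (k + 1) * Cmod (b (k + 1)%nat)))
  (Hsum : Series (fun k : nat => coefA alpha (k + 2) * Cmod (a (k + 2)%nat)) +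
          Series (fun k : nat => coefB alpha (k + 1) * Cmod (b (k + 1)%nat))
          <= 2 * sin (PI * alpha / 2)) :
  class_SSH alpha f.
Proof.
  destruct (half_angle alpha Halpha) as [Hs [Hc [Hsc [Hcos2 Hsin2]]]].
  set (s := sin (PI * alpha / 2)) in *. set (c := cos (PI * alpha / 2)) in *.
  (* [f z = z + H z + conj (g z)], where [H] has the coefficients [d] *)
  set (H := fun z => (h z - z)%C). set (d := drop_linear a).
  assert (Hf_eq : forall z, disk 1 z -> f z = (z + H z + Cconj (g z))%C)
    by (intros z Hz; rewrite (Hfhg z Hz); unfold H; ring).
  assert (HHd : forall z, disk 1 z -> is_pseries d z (H z))
    by (intros z Hz; apply drop_linear_pseries; auto).
  set (SA := Series _) in Hsum. set (SB := Series _) in Hsum.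
  assert (HA : is_series (fun n => coefA alpha n * Cmod (d n)) SA).
  { apply (is_series_from _ 2).
    - intros [| [| n]] Hn; [| | lia]; simpl; rewrite Cmod_0; apply Rmult_0_r.
    - eapply is_series_ext; [| exact (Series_correct _ HexA)].
      intro n. cbv beta. rewrite (Nat.add_comm n 2). reflexivity. }
  assert (HB : is_series (fun n => coefB alpha n * Cmod (b n)) SB).
  { apply (is_series_from _ 1).
    - intros [| n] Hn; [| lia]. rewrite Hb0, Cmod_0. apply Rmult_0_r.
    - eapply is_series_ext; [| exact (Series_correct _ HexB)].
      intro n. cbv beta. rewrite (Nat.add_comm n 1). reflexivity. }
  assert (Hpos : forall (u : nat -> C) n, 0 <= INR n * Cmod (u n))
    by (intros; apply Rmult_le_pos; [apply pos_INR | apply Cmod_ge_0]).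
  destruct (dominated_series (fun n => INR n * Cmod (d n))
              (fun n => coefA alpha n * Cmod (d n)) (2 * s) SA
              ltac:(lra) (Hpos d)) as [Sa [HSa [HSa0 HSaA]]].
  { intros [| n]; [simpl; rewrite Cmod_0; lra |].
    pose proof (coefA_lower alpha (S n) Halpha ltac:(lia)) as HAn. fold s in HAn.
    pose proof (Cmod_ge_0 (d (S n))). nra. }
  { exact HA. }
  destruct (dominated_series (fun n => INR n * Cmod (b n))
              (fun n => coefB alpha n * Cmod (b n)) 2 SB
              ltac:(lra) (Hpos b)) as [Sb [HSb [HSb0 HSbB]]].
  { intros [| n]; [simpl; rewrite Hb0, Cmod_0; lra |].
    pose proof (coefB_lower alpha (S n) ltac:(lia)).
    pose proof (Cmod_ge_0 (b (S n))). nra. }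
  { exact HB. }
  assert (Hs1 : s < 1) by nra.
  assert (Hcontr : forall rho, 0 <= rho < 1 -> rho * Sa + Sb < 1).
  { intros rho Hrho. apply (convex_combination_lt_1 rho (2 * s)); lra. }
  assert (Hlip : forall rho z1 z2, rho < 1 -> Cmod z1 <= rho -> Cmod z2 <= rho ->
    Cmod ((f z1 - z1) - (f z2 - z2)) <= (rho * Sa + Sb) * Cmod (z1 - z2)).
  { intros rho z1 z2 Hrho H1 H2.
    assert (Hrho0 : 0 <= rho) by (pose proof (Cmod_ge_0 z1); lra).
    rewrite !Hf_eq by (unfold disk; lra).
    replace (z1 + H z1 + Cconj (g z1) - z1 - (z2 + H z2 + Cconj (g z2) - z2))%C
      with ((H z1 - H z2) + Cconj (g z1 - g z2))%C by (rewrite Cminus_conj; ring).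
    eapply Rle_trans; [apply Cmod_triangle |]. rewrite Cmod_conj, Rmult_plus_distr_r.
    assert (Hpow : forall n, rho ^ n <= 1).
    { intro n. apply pow_le_1. lra. }
    apply Rplus_le_compat.
    - apply pseries_lipschitz with (c := d) (rho := rho)
        (v := fun n => rho * (INR n * Cmod (d n))); try assumption; try lra.
      + intros [| [| n]]; [simpl; lra | simpl; rewrite Cmod_0; lra |].
        replace (rho ^ pred (S (S n))) with (rho * rho ^ n) by reflexivity.
        pose proof (Hpos d (S (S n))). pose proof (Hpow n).
        assert (rho * (INR (S (S n)) * Cmod (d (S (S n)))) * rho ^ n
                <= rho * (INR (S (S n)) * Cmod (d (S (S n)))) * 1).
        { apply Rmult_le_compat_l; [apply Rmult_le_pos; assumption | assumption]. }
        lra.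
      + exact (is_series_scal_l (K := R_AbsRing) (V := R_NormedModule) rho _ _ HSa).
    - apply pseries_lipschitz with (c := b) (rho := rho)
        (v := fun n => INR n * Cmod (b n)); try assumption; try lra.
      intro n. pose proof (Hpos b n). pose proof (Hpow (pred n)). nra. }
  assert (Hwirt : forall z, disk 1 z -> exists p q, wirtinger f z p q /\
    Cmod q < Cmod p /\
    0 <= Re ((RtoC (tan (PI * alpha / 2)) - Ci) * f z * Cconj (z * p - Cconj z * q)) /\
    0 <= Re ((RtoC (tan (PI * alpha / 2)) + Ci) * f z * Cconj (z * p - Cconj z * q))).
  { intros z Hz. unfold disk in Hz.
    destruct (pseries_derivative d H Sa z Hz HHd HSa) as [l [Hl HlH]].
    destruct (pseries_derivative b g Sb z Hz Hgb HSb) as [q [Hq Hqg]].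
    exists (1 + l)%C, (Cconj q).
    split; [apply wirtinger_id_plus with (H := H) (g := g); assumption |].
    assert (Hzpow : forall n, Cmod z ^ n <= 1).
    { intro n. apply pow_le_1. split; [apply Cmod_ge_0 | lra]. }
    split.
    - rewrite Cmod_conj.
      assert (Hl' : Cmod l <= Cmod z * Sa).
      { refine (is_series_Cmod_le _ _ _ _ Hl
          (is_series_scal_l (K := R_AbsRing) (V := R_NormedModule) (Cmod z) _ _ HSa) _).
        intro n. change (Cmod (RtoC (INR n) * d n * z ^ pred n)
                         <= Cmod z * (INR n * Cmod (d n))).
        destruct n as [| [| n]];
          [change (d O) with (RtoC 0); rewrite !Cmod_mult, Cmod_0; lra
          |change (d 1%nat) with (RtoC 0); rewrite !Cmod_mult, Cmod_0; lra |].
        rewrite !Cmod_mult, Cmod_pow, Cmod_R, Rabs_pos_eq by apply pos_INR.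
        change (INR (S (S n)) * Cmod (d (S (S n))) * (Cmod z * Cmod z ^ n)
                <= Cmod z * (INR (S (S n)) * Cmod (d (S (S n))))).
        pose proof (Rmult_le_pos _ _ (Cmod_ge_0 z) (Hpos d (S (S n)))).
        pose proof (Hzpow n). nra. }
      assert (Hq' : Cmod q <= Sb).
      { refine (is_series_Cmod_le _ _ _ _ Hq HSb _). intro n.
        rewrite !Cmod_mult, Cmod_pow, Cmod_R, Rabs_pos_eq by apply pos_INR.
        pose proof (Hpos b n). pose proof (Hzpow (pred n)). nra. }
      pose proof (Hcontr (Cmod z) (conj (Cmod_ge_0 z) Hz)).
      pose proof (Cmod_triangle_inv 1 l) as HT. rewrite Cmod_1 in HT. lra.
    - (* [e] stands for either of the conjugate numbers [exp (+- i pi alpha)], which give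
         the two half-planes *)
      assert (Hside : forall e, Re e = cos (PI * alpha) -> Im e ^ 2 = sin (PI * alpha) ^ 2 ->
        0 <= Re ((1 - e) * f z * Cconj (z * (1 + l) - Cconj z * Cconj q))).
      { intros e He1 He2.
        assert (Hnorm : forall x y t, 0 <= t -> x ^ 2 + y ^ 2 = t ^ 2 -> Cmod (x, y) = t).
        { intros x y t Ht E. unfold Cmod. simpl fst; simpl snd. rewrite E. apply sqrt_pow2. assumption. }
        assert (He : Cmod e = 1).
        { destruct e as [e1 e2]. simpl in He1, He2. apply Hnorm; [lra |].
          pose proof (sin2_cos2 (PI * alpha)) as HP. unfold Rsqr in HP. subst e1. nra. }
        assert (H1e : Cmod (1 - e) = 2 * s).
        { destruct e as [e1 e2]. simpl in He1, He2. apply Hnorm; [lra |].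
          rewrite Hcos2 in He1. rewrite Hsin2 in He2. simpl. subst e1. nra. }
        destruct (split_series (fun n => Cmod (RtoC (INR n) - RtoC 1) * Cmod (d n))
          (fun n => Cmod (RtoC (INR n) - e) * Cmod (d n))
          (fun n => coefA alpha n * Cmod (d n)) SA)
          as [T1 [T2 [HT1 [HT2 HT12]]]].
        { intro n. apply Rmult_le_pos; apply Cmod_ge_0. }
        { intro n. apply Rmult_le_pos; apply Cmod_ge_0. }
        { intros [| n]; [simpl; rewrite Cmod_0; ring |].
          rewrite (coefA_unit alpha e) by assumption. rewrite <- RtoC_minus, Cmod_R.
          rewrite Rabs_pos_eq; [ring |]. rewrite S_INR. pose proof (pos_INR n). lra. }
        { exact HA. }
        destruct (split_series (fun n => Cmod (RtoC (INR n) - - RtoC 1) * Cmod (b n))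
          (fun n => Cmod (RtoC (INR n) - - Cconj e) * Cmod (b n))
          (fun n => coefB alpha n * Cmod (b n)) SB)
          as [T3 [T4 [HT3 [HT4 HT34]]]].
        { intro n. apply Rmult_le_pos; apply Cmod_ge_0. }
        { intro n. apply Rmult_le_pos; apply Cmod_ge_0. }
        { intro n. rewrite (coefB_unit alpha e) by assumption. rewrite <- RtoC_opp, <- RtoC_minus, Cmod_R.
          rewrite Rabs_pos_eq; [ring |]. pose proof (pos_INR n). lra. }
        { exact HB. }
        rewrite (Hf_eq z Hz).
        apply (euler_halfplane d b H g z l q e T1 T2 T3 T4); try assumption; try reflexivity.
        rewrite H1e. lra. }
      assert (Hscale : forall t x, 0 < t -> 0 <= Re (RtoC t * x) -> 0 <= Re x).
      { intros t [x1 x2] Ht. simpl. intro. nra. }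
      assert (Htan : tan (PI * alpha / 2) = s / c) by reflexivity. rewrite Htan.
      (* [1 - e] is [2 s c (tau +- Ci)] *)
      assert (Hsc0 : 0 < 2 * s * c) by nra.
      split.
      + apply (Hscale (2 * s * c) _ Hsc0).
        replace (RtoC (2 * s * c) * ((RtoC (s / c) - Ci) * f z * Cconj (z * (1 + l) - Cconj z * Cconj q)))%C
          with ((1 - (cos (PI * alpha), sin (PI * alpha))) * f z
                * Cconj (z * (1 + l) - Cconj z * Cconj q))%C.
        * apply Hside; simpl; reflexivity.
        * rewrite !Cmult_assoc. do 2 f_equal. rewrite Hcos2, Hsin2.
          apply injective_projections; simpl; field; lra.
      + apply (Hscale (2 * s * c) _ Hsc0).
        replace (RtoC (2 * s * c) * ((RtoC (s / c) + Ci) * f z * Cconj (z * (1 + l) - Cconj z * Cconj q)))%C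
          with ((1 - (cos (PI * alpha), (- sin (PI * alpha))%R)) * f z
                * Cconj (z * (1 + l) - Cconj z * Cconj q))%C.
        * apply Hside; simpl; [reflexivity | ring].
        * rewrite !Cmult_assoc. do 2 f_equal. rewrite Hcos2, Hsin2.
          apply injective_projections; simpl; field; lra. }
  assert (Htan0 : 0 < tan (PI * alpha / 2)) by (apply Rdiv_lt_0_compat; assumption).
  split; [exact Hf |]. split; [| split].
  - intros z Hz. destruct (Hwirt z Hz) as [p [q [Hpq [Hqp _]]]].
    destruct (wirtinger_derivatives f z p q Hpq) as [Ep Eq].
    unfold jacobian. rewrite Ep, Eq. pose proof (Cmod_ge_0 q). nra.
  - intros z1 z2 Hz1 Hz2 E. unfold disk in Hz1, Hz2.
    set (rho := Rmax (Cmod z1) (Cmod z2)).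
    assert (Hrho : rho < 1) by (apply Rmax_lub_lt; assumption).
    assert (H1 : Cmod z1 <= rho) by apply Rmax_l.
    assert (H2 : Cmod z2 <= rho) by apply Rmax_r.
    pose proof (Cmod_ge_0 z1).
    pose proof (Hlip rho z1 z2 Hrho H1 H2) as HL. rewrite E in HL.
    replace (f z2 - z1 - (f z2 - z2))%C with (z2 - z1)%C in HL by ring.
    rewrite (Cmod_minus_sym z2) in HL.
    pose proof (Hcontr rho ltac:(lra)). pose proof (Cmod_ge_0 (z1 - z2)).
    apply Cmod_minus_le_0. nra.
  - intros r Hr.
    (* any radius strictly between [r] and [1] *)
    set (rho := (1 + r) / 2).
    apply strongly_starlike_of_halfplanes with (rho := rho) (L := rho * Sa + Sb).
    + exact Htan0.
    + unfold rho; lra.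
    + split; [unfold rho; apply Rplus_le_le_0_compat; [apply Rmult_le_pos; lra | lra] |].
      apply Hcontr. unfold rho; lra.
    + apply Hf.
    + intros z1 z2. apply Hlip. unfold rho; lra.
    + intros z Hz. apply Hwirt. unfold disk. lra.
Qed.
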